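(* Let $d \geq 1$ be an integer, let $1 \leq p,q \leq \infty$ with Hölder conjugates $p'$ and $q'$, and let $\nu \geq 0$. Let $v = v(t,x)$ be a fixed, divergence free vector field in $L^{p'}(\mathbb{R}_+, \dot{W}^{1,q'}(\mathbb{R}^d))$. Let $\varphi_0$ be a smooth, compactly supported function in $\mathbb{R}^d$. Then there exists a function $\varphi$ in $L^{\infty}(\mathbb{R}_+ \times \mathbb{R}^d)$ solving $$\partial_t \varphi - \nabla \cdot (\varphi v) - \nu \Delta \varphi = 0, \qquad \varphi(0) = \varphi_0$$ in the sense of distributions and satisfying, for almost every $t>0$, the estimate $$\|\varphi(t)\|_{L^{\infty}(\mathbb{R}^d)} \leq \|\varphi_0\|_{L^{\infty}(\mathbb{R}^d)}.$$
   Context: $\mathbb{R}_+ = [0,\infty)$. $\dot{W}^{1,r}(\mathbb{R}^d)$ is the homogeneous Sobolev space of functions whose distributional gradient lies in $L^r(\mathbb{R}^d)$. Divergence free means $\nabla\cdot v(t,\cdot)=0$ in the sense of distributions. The functions $\varphi$ and $\varphi_0$ are scalar. Solving the Cauchy problem in the sense of distributions includes the initial condition: it means that for every smooth compactly supported $\psi$ on $[0,\infty)\times\mathbb{R}^d$, $\int_0^\infty\int_{\mathbb{R}^d}\varphi\,(\partial_t\psi - v\cdot\nabla\psi+\nu\Delta\psi)\,dx\,dt = -\int_{\mathbb{R}^d}\varphi_0(x)\psi(0,x)\,dx$.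
   Formalization: The vector field v is additionally assumed locally integrable on [0,∞)×R^d; the homogeneous seminorm ignores constants in x, and for v = e_1/t the claim fails whenever φ_0 is not zero. *)

(* Defs.v *)
From HB Require Import structures.
From mathcomp Require Import all_boot all_order all_algebra.
From mathcomp Require Import all_classical all_reals all_analysis.
Set Implicit Arguments.
Unset Strict Implicit.
Unset Printing Implicit Defensive.
Import Order.TTheory GRing.Theory Num.Theory.
Import numFieldNormedType.Exports.

Local Open Scope classical_set_scope.
Local Open Scope ring_scope.

(* The sigma-algebra on R^n generated by the n coordinates; since R is second
   countable, it is the Borel sigma-algebra. *)
Definition rV_display : measure_display.
Proof. exact: default_measure_display. Qed.

Section measurable_rV.
Context {R : realType} (n : nat).

Definition rV_measurable : set (set 'rV[R]_n) :=
  g_sigma_preimage (fun i (x : 'rV[R]_n) => x ord0 i : measurableTypeR R).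

Let rV_measurable0 : rV_measurable set0.
Proof. exact: sigma_algebra0. Qed.

Let rV_measurableC A : rV_measurable A -> rV_measurable (~` A).
Proof. exact: sigma_algebraC. Qed.

Let rV_measurable_bigcup (F : (set 'rV[R]_n)^nat) :
  (forall i, rV_measurable (F i)) -> rV_measurable (\bigcup_i (F i)).
Proof. exact: sigma_algebra_bigcup. Qed.

HB.instance Definition _ := @isMeasurable.Build rV_display 'rV[R]_n
  rV_measurable rV_measurable0 rV_measurableC rV_measurable_bigcup.

End measurable_rV.

Section lebesgue_measure_rV.
Context {R : realType}.

Lemma measurable_rV_coord n (i : 'I_n) :
  measurable_fun [set: 'rV[R]_n] (fun x : 'rV[R]_n => x ord0 i).
Proof.
move=> _ Y mY; rewrite setTI; apply: sub_sigma_algebra => /=.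
rewrite -bigcup_seq/=; exists i => /=; first by rewrite mem_index_enum.
by exists Y => //; rewrite setTI.
Qed.

Lemma measurable_fun_rVP d (T : measurableType d) n (f : T -> 'rV[R]_n) :
  (forall i, measurable_fun [set: T] (fun t => f t ord0 i)) ->
  measurable_fun [set: T] f.
Proof.
move=> mf _ A; pose F := image_set_system setT f measurable.
have sF : sigma_algebra setT F by apply: sigma_algebra_image; exact: sigma_algebra_measurable.
rewrite setTI => mA; suff : F A by rewrite /F /image_set_system /= setTI.
apply: mA; split => // B; rewrite -bigcup_seq => -[i _ [C mC <-]].
by rewrite /F /image_set_system /= !setTI -[X in measurable X]setTI; exact: mf.
Qed.

Definition cons_rV n (z : measurableTypeR R * 'rV[R]_n) : 'rV[R]_n.+1 :=
  \row_i (if unlift ord0 i is Some j then z.2 ord0 j else z.1).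

Lemma measurable_cons_rV n : measurable_fun setT (@cons_rV n).
Proof.
apply: measurable_fun_rVP => i; under eq_fun do rewrite mxE.
case: unliftP => [j _|_]; last exact: measurable_fst.
exact: (measurableT_comp (measurable_rV_coord j) measurable_snd).
Qed.

Section step.
Context n (m : {sigma_finite_measure set 'rV[R]_n -> \bar R}).

Definition cons_measure : set 'rV[R]_n.+1 -> \bar R :=
  pushforward (lebesgue_measure \x m)%E (@cons_rV n).

Let cons_measure0 : cons_measure set0 = 0%E.
Proof. by apply: measure0; exact: measurable_cons_rV. Qed.

Let cons_measure_ge0 A : (0 <= cons_measure A)%E.
Proof. by apply: measure_ge0; exact: measurable_cons_rV. Qed.

Let cons_measure_sigma_additive : semi_sigma_additive cons_measure.
Proof. by apply: measure_semi_sigma_additive; exact: measurable_cons_rV. Qed.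

HB.instance Definition _ := isMeasure.Build _ _ _ cons_measure
  cons_measure0 cons_measure_ge0 cons_measure_sigma_additive.

Lemma cons_measure_sigma_finite : sigma_finite setT cons_measure.
Proof.
have /sigma_finiteP[F [TF ndF Foo]] := sigma_finiteT (@lebesgue_measure R).
have /sigma_finiteP[G [TG ndG Goo]] := sigma_finiteT m.
pose u (x : 'rV[R]_n.+1) : measurableTypeR R * 'rV[R]_n :=
  (x ord0 ord0, \row_j x ord0 (lift ord0 j)).
have uK : cancel (@cons_rV n) u.
  move=> [a b]; rewrite /u /cons_rV /= mxE unlift_none; congr pair.
  by apply/rowP => j; rewrite !mxE liftK.
have mu_ : measurable_fun setT u.
  apply: measurable_fun_pair; first exact: measurable_rV_coord.
  apply: measurable_fun_rVP => i; under eq_fun do rewrite mxE.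
  exact: measurable_rV_coord.
exists (fun k => u @^-1` (F k `*` G k)) => [|k].
  apply/esym/seteqP; split => // x _.
  have [i _ Fi] : (\bigcup_i F i) (u x).1 by rewrite -TF.
  have [j _ Gj] : (\bigcup_j G j) (u x).2 by rewrite -TG.
  exists (maxn i j) => //; split.
  - by move: Fi; exact/subsetPset/ndF/leq_maxl.
  - by move: Gj; exact/subsetPset/ndG/leq_maxr.
have [[mF Fk] [mG Gk]] := (Foo k, Goo k); split.
  by rewrite -[X in measurable X]setTI; apply: mu_ => //; exact: measurableX.
rewrite /cons_measure /pushforward -comp_preimage.
rewrite (_ : u \o _ = id); last by apply/funext => z; exact: uK.
by rewrite preimage_id product_measure1E// lte_mul_pinfty// ge0_fin_numE.
Qed.

HB.instance Definition _ := @Measure_isSigmaFinite.Build _ _ _ cons_measure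
  cons_measure_sigma_finite.

End step.

(* Lebesgue measure on R^n: the unit mass when n = 0, and lambda^1 (x) lambda^n
   transported by (a, x) |-> (a, x_0, ..., x_(n-1)) when passing from n to n+1. *)
Fixpoint lebesgue_measure_rV n : {sigma_finite_measure set 'rV[R]_n -> \bar R} :=
  if n is m.+1 then cons_measure (lebesgue_measure_rV m) else \d_(0 : 'rV[R]_0).

Lemma lebesgue_measure_rV_box n (A : 'I_n -> set (measurableTypeR R)) :
  (forall i, measurable (A i)) ->
  lebesgue_measure_rV n [set x | forall i, A i (x ord0 i)] =
  (\prod_(i < n) lebesgue_measure (A i))%E.
Proof.
elim: n A => [|n IHn] A mA.
  by rewrite big_ord0 /= diracE (_ : _ \in _ = true)//; apply: mem_set => -[].
have mB : measurable [set x : 'rV[R]_n | forall i, A (lift ord0 i) (x ord0 i)].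
  rewrite [X in measurable X](_ : _ = \bigcap_(i in [set: 'I_n])
      ((fun x : 'rV[R]_n => x ord0 i) @^-1` A (lift ord0 i))); last first.
    by apply/seteqP; split => [x Ax i _|x Ax i]; [exact: Ax|exact: (Ax i I)].
  apply: fin_bigcap_measurable => // i _.
  by have := measurable_rV_coord i measurableT (mA (lift ord0 i)); rewrite setTI; exact.
rewrite big_ord_recl -(IHn (fun i => A (lift ord0 i))); last by move=> i; exact: mA.
rewrite -(product_measure1E lebesgue_measure (lebesgue_measure_rV n))//.
rewrite /= /cons_measure /pushforward; congr (product_measure1 _ _ _).
apply/seteqP; split => -[a b] /=.
  move=> Aab; split => [|i].
    by have := Aab ord0; rewrite mxE unlift_none.
  by have := Aab (lift ord0 i); rewrite mxE liftK.
move=> [Aa Ab] i; rewrite mxE.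
by case: unliftP => [j ->|->].
Qed.

End lebesgue_measure_rV.

Section smooth_functions.
Context {R : realType}.

(* The iterated derivative of f along the directions listed in s (innermost
   derivative last). *)
Definition iter_derive (V : normedModType R) (s : seq V) (f : V -> R) : V -> R :=
  foldr (fun w g x => 'D_w g x) f s.

(* C^oo for finite-dimensional V: derivatives of every order exist and are
   continuous. *)
Definition smooth (V : normedModType R) (f : V -> R) :=
  forall s : seq V, continuous (iter_derive s f) /\
    forall w x, derivable (iter_derive s f) x w.

Definition smooth_compact (V : normedModType R) (f : V -> R) :=
  smooth f /\ compact (closure [set x | f x != 0]).

End smooth_functions.

Section transport_diffusion.
Context {R : realType} {d : nat}.
Implicit Types (u : 'rV[R]_d -> 'rV[R]_d) (v : R -> 'rV[R]_d -> 'rV[R]_d).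

Local Notation vol := (lebesgue_measure_rV d : {measure set 'rV[R]_d -> \bar R}).
Local Notation e i := (delta_mx ord0 i : 'rV[R]_d).

Definition spacetime_measure : {measure set (measurableTypeR R * 'rV[R]_d) -> \bar R} :=
  (lebesgue_measure \x lebesgue_measure_rV d)%E.

Definition half_line : set R := `[0, +oo[.

Definition spacetime : set (R * 'rV[R]_d) := half_line `*` setT.

(* Integrability on K includes measurability on K. *)
Definition loc_integrable_space (f : 'rV[R]_d -> R) :=
  forall K : set 'rV[R]_d, compact K -> vol.-integrable K (EFin \o f).

Definition loc_integrable_spacetime (f : R * 'rV[R]_d -> R) :=
  forall K : set (R * 'rV[R]_d), compact K -> K `<=` spacetime ->
    spacetime_measure.-integrable K (EFin \o f).

(* g is the distributional gradient of the vector field u, with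
   g x i j = d_j u_i (x). *)
Definition weak_gradient u (g : 'rV[R]_d -> 'M[R]_d) :=
  forall psi : 'rV[R]_d -> R, smooth_compact psi -> forall i j,
    \int[vol]_x (u x ord0 i * 'D_(e j) psi x) = - \int[vol]_x (g x i j * psi x).

(* u belongs to the homogeneous Sobolev space W^{1,r} and g is its gradient. The
   norm on matrices is the maximum of the entries. *)
Definition homogeneous_sobolev (r : \bar R) u (g : 'rV[R]_d -> 'M[R]_d) :=
  [/\ forall i, loc_integrable_space (fun x => u x ord0 i),
      forall i j, measurable_fun setT (fun x => g x i j),
      weak_gradient u g &
      ('N[vol]_r[(fun x => `|g x|%:E)] < +oo)%E].

(* v belongs to L^s(R_+, W^{1,r}), W^{1,r} homogeneous. As the seminorm of W^{1,r}
   does not see the constants, local integrability in (t, x), without which the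
   product phi v is not a distribution, has to be part of the definition. *)
Definition Lp_homogeneous_sobolev (s r : \bar R) v :=
  (forall i, loc_integrable_spacetime (fun z => v z.1 z.2 ord0 i)) /\
  exists G : R -> 'rV[R]_d -> 'M[R]_d,
    [/\ forall i j, measurable_fun spacetime (fun z => G z.1 z.2 i j),
        {ae lebesgue_measure, forall t : R, 0 < t -> homogeneous_sobolev r (v t) (G t)} &
        ('N[lebesgue_measure]_s[(fun t => 'N[vol]_r[(fun x => `|G t x|%:E)]) \_ half_line] < +oo)%E].

Definition divergence_free v :=
  {ae lebesgue_measure, forall t : R, 0 < t ->
    forall psi : 'rV[R]_d -> R, smooth_compact psi ->
      \int[vol]_x (\sum_(i < d) v t x ord0 i * 'D_(e i) psi x) = 0}.

Definition Linfty_spacetime (phi : R -> 'rV[R]_d -> R) :=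
  measurable_fun spacetime (fun z => phi z.1 z.2) /\
  ('N[spacetime_measure]_+oo[(fun z => (phi z.1 z.2)%:E) \_ spacetime] < +oo)%E.

Definition space_dir (i : 'I_d) : R * 'rV[R]_d := (0, e i).

(* d_t phi - div (phi v) - nu Delta phi = 0, phi(0) = phi0; the test functions on
   [0, +oo) x R^d are the restrictions of those on R x R^d. *)
Definition transport_diffusion_solution (nu : R) v (phi0 : 'rV[R]_d -> R)
    (phi : R -> 'rV[R]_d -> R) :=
  forall psi : R * 'rV[R]_d -> R, smooth_compact psi ->
    \int[spacetime_measure]_(z in spacetime)
      (phi z.1 z.2 *
        ('D_(1, 0) psi z
         - \sum_(i < d) v z.1 z.2 ord0 i * 'D_(space_dir i) psi z
         + nu * \sum_(i < d) 'D_(space_dir i) (fun y => 'D_(space_dir i) psi y) z))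
    = - \int[vol]_x (phi0 x * psi (0, x)).

End transport_diffusion.

(* Main.v *)
Require Import Defs.
From HB Require Import structures.
From mathcomp Require Import all_boot all_order all_algebra.
From mathcomp Require Import all_classical all_reals all_analysis.
From mathcomp Require Import measurable_realfun ess_sup_inf.
From mathcomp Require Import ring lra.
Set Implicit Arguments.
Unset Strict Implicit.
Unset Printing Implicit Defensive.
Import Order.TTheory GRing.Theory Num.Theory.
Import numFieldNormedType.Exports.
Local Open Scope classical_set_scope.
Local Open Scope ring_scope.

(** The proof is by duality, and no equation is solved.  Let S be the space-time
    half space and, for a test function psi, put

      T psi = d_t psi - v . grad psi + nu Delta psi,

    so that a solution is a bounded phi with
    int_S phi (T psi) = - int phi0 psi(0, .) for all psi.  On the space of all
    T psi, a subspace of L^1(S), this prescribes a linear functional, and it is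
    the restriction of a functional given by a phi with |phi| <= M = |phi0|_oo as
    soon as it is bounded by M times the L^1 norm.  Everything thus follows from
    the a priori estimate [L1_estimate]

      int |psi(0, x)| dx <= int_S |T psi|,

    from the Hahn-Banach theorem ([L1_extension]) and from the duality between
    L^1 and L^oo ([L1_dual]); the latter also gives the maximum principle, since
    phi can be chosen with |phi| <= M at every point.

    The a priori estimate is the renormalization argument, applied to the
    smooth function psi instead of the solution.  Let
    b(s) = sqrt(s^2 + eps^2) - eps, a smooth convex approximation of the modulus
    with b(0) = 0 and |b'| <= 1.  Multiplying by b'(psi),

      b'(psi) T psi <= d_t b(psi) - v . grad b(psi)
                         + nu sum_i d_i (b'(psi) d_i psi),

    because the missing term nu b''(psi) |grad psi|^2 has a sign.  Integrated
    over S, the first term gives - int b(psi(0, x)) dx by the fundamental theorem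
    of calculus; the second vanishes because v(t, .) is divergence free and
    b(psi(t, .)) is again a test function; the third is a divergence.  Hence
    int b(psi(0, x)) dx <= int_S |T psi| ([regularized_energy_estimate]), and eps
    tends to 0. *)

(** * The Hahn-Banach theorem *)

Section hahn_banach.
Context {R : realType} {V : lmodType R}.
Implicit Types (p q : V -> R) (C : set (V * R)).

Definition sublinear q :=
  q 0 = 0 /\ forall (a : R) x y, 0 <= a -> q (a *: x + y) <= a * q x + q y.

(** The largest sublinear minorant of q that is at most - r at - v for all (v, r)
    in the cone C.  Both halves of the proof of the Hahn-Banach theorem lower a
    sublinear functional this way: once along the graph of the functional to be
    extended, once along a single half-line to show that a minimal sublinear
    functional is additive. *)
Definition cone_inf q C x := inf [set q (x + c.1) - c.2 | c in C].

Section cone_inf.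
Variables (q : V -> R) (C : set (V * R)).
Hypotheses (q_sub : sublinear q) (C0 : C (0, 0)).
Hypothesis C_cone : forall (a : R) c c', 0 <= a -> C c -> C c' ->
  C (a *: c.1 + c'.1, a * c.2 + c'.2).
Hypothesis C_le : forall c, C c -> c.2 <= q c.1.

Let q_add x y : q (x + y) <= q x + q y.
Proof. by have := q_sub.2 1 x y ler01; rewrite scale1r mul1r. Qed.

Let lb x c : C c -> - q (- x) <= q (x + c.1) - c.2.
Proof.
move=> Cc; have := q_add (x + c.1) (- x); rewrite addrAC subrr add0r => h.
have := C_le Cc; lra.
Qed.

Lemma cone_inf_le x c : C c -> cone_inf q C x <= q (x + c.1) - c.2.
Proof.
move=> Cc; apply: ge_inf; last by exists c.
by exists (- q (- x)) => _ [c' Cc' <-]; exact: lb.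
Qed.

Lemma le_cone_inf x r : (forall c, C c -> r <= q (x + c.1) - c.2) ->
  r <= cone_inf q C x.
Proof.
move=> h; apply: lb_le_inf; first by exists (q (x + 0) - 0), (0, 0).
by move=> _ [c Cc <-]; exact: h.
Qed.

Lemma cone_inf_sublinear : sublinear (cone_inf q C).
Proof.
split.
  apply/eqP; rewrite eq_le; apply/andP; split.
    by have := cone_inf_le 0 C0; rewrite /= addr0 subr0 q_sub.1.
  by apply: le_cone_inf => c Cc; have := lb 0 Cc; rewrite oppr0 q_sub.1 oppr0 add0r.
move=> a x y a0; rewrite -lerBlDl; apply: le_cone_inf => c' Cc'.
rewrite lerBlDr -lerBlDl.
have H c : C c -> cone_inf q C (a *: x + y) - (q (y + c'.1) - c'.2) <=
    a * (q (x + c.1) - c.2).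
  move=> Cc; have := cone_inf_le (a *: x + y) (C_cone a0 Cc Cc') => /=.
  rewrite addrACA -scalerDr.
  have := q_sub.2 a (x + c.1) (y + c'.1) a0; rewrite mulrBr; lra.
have [a_eq0|an0] := eqVneq a 0.
  by have := H _ C0; rewrite a_eq0 !mul0r.
have a_gt0 : 0 < a by rewrite lt_neqAle eq_sym an0.
rewrite -ler_pdivrMl//; apply: le_cone_inf => c Cc.
by rewrite ler_pdivrMl//; exact: H.
Qed.

End cone_inf.

(** Zorn's lemma applies because the infimum of a chain of sublinear functionals
    is sublinear: two members of the chain are both bounded below by the smaller
    of the two.  The bound - p (- x) keeps the infima finite. *)
Lemma minimal_sublinear p : sublinear p ->
  exists q, [/\ sublinear q, forall x, q x <= p x &
    forall q', sublinear q' -> (forall x, q' x <= q x) -> q' = q].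
Proof.
move=> p_sub; pose S := {q | sublinear q /\ forall x, q x <= p x}.
pose below (f g : S) := `[< forall x, sval g x <= sval f x >].
have S_eq (f g : S) : sval f = sval g -> f = g by exact: eq_sig_hprop.
case: (@Zorn S below).
- by move=> f; apply/asboolP.
- by move=> f g h /asboolP fg /asboolP gh; apply/asboolP => x; exact: le_trans (fg x).
- move=> f g /asboolP fg /asboolP gf; apply: S_eq; apply/funext => x.
  by apply/eqP; rewrite eq_le fg gf.
- move=> A chainA.
  have [[f0 Af0]|A0] := pselect (exists f, A f); last first.
    by exists (exist _ p (conj p_sub (fun=> lexx _))) => f Af; case: A0; exists f.
  pose B x := [set sval f x | f in A].
  have subadd (f : S) x : - p (- x) <= sval f x.
    have [[f00 /(_ 1 x (- x) ler01) fD] fp] := svalP f.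
    by move: fD; rewrite scale1r mul1r subrr f00; have := fp (- x); lra.
  have B_le f x : A f -> inf (B x) <= sval f x.
    move=> Af; apply: ge_inf; last by exists f.
    by exists (- p (- x)) => _ [g _ <-]; exact: subadd.
  have B_ge r x : (forall f, A f -> r <= sval f x) -> r <= inf (B x).
    move=> h; apply: lb_le_inf; first by exists (sval f0 x), f0.
    by move=> _ [f Af <-]; exact: h.
  have B_sub : sublinear (fun x => inf (B x)).
    split.
      apply/eqP; rewrite eq_le; apply/andP; split.
        by rewrite -[leRHS](svalP f0).1.1; exact: B_le.
      by apply: (B_ge) => f _; rewrite (svalP f).1.1.
    move=> a x y a0; rewrite -lerBlDl; apply: (B_ge) => g Ag.
    rewrite lerBlDr -lerBlDl.
    have H f : A f -> inf (B (a *: x + y)) - sval g y <= a * sval f x.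
      move=> Af; rewrite lerBlDr.
      have : exists2 h, A h & sval h x <= sval f x /\ sval h y <= sval g y.
        have [/asboolP fg|/asboolP gf] := chainA _ _ Af Ag; first by exists g.
        by exists f.
      move=> [h Ah [hf hg]]; have := B_le h (a *: x + y) Ah.
      have := (svalP h).1.2 a x y a0; have := ler_wpM2l a0 hf; lra.
    have [a_eq0|an0] := eqVneq a 0.
      by have := H _ Af0; rewrite a_eq0 !mul0r.
    have a_gt0 : 0 < a by rewrite lt_neqAle eq_sym an0.
    rewrite -ler_pdivrMl//; apply: (B_ge) => f Af.
    by rewrite ler_pdivrMl//; exact: H.
  have B_p x : inf (B x) <= p x by exact: le_trans (B_le _ _ Af0) ((svalP f0).2 x).
  exists (exist _ (fun x => inf (B x)) (conj B_sub B_p)) => f Af.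
  by apply/asboolP => x /=; exact: B_le.
move=> [q [q_sub qp]] q_min; exists q; split => // q' q'_sub q'q.
have q'p x : q' x <= p x by exact: le_trans (q'q x) (qp x).
have /(_ _)/(congr1 sval) := q_min (exist _ q' (conj q'_sub q'p)).
by apply; apply/asboolP.
Qed.

(** The functional to be extended is given by its graph C, a linear subspace, so
    that it need not be known in advance to be well defined.  A minimal sublinear
    q below [cone_inf p C] is linear, since lowering it along the half-line spanned
    by any y cannot change it; and q v <= r, r <= q v for (v, r) in C come from C
    being stable under opposites. *)
Theorem hahn_banach p C : sublinear p -> C (0, 0) ->
  (forall (a : R) c c', C c -> C c' -> C (a *: c.1 + c'.1, a * c.2 + c'.2)) ->
  (forall c, C c -> c.2 <= p c.1) ->
  exists L : V -> R, [/\ forall a x y, L (a *: x + y) = a * L x + L y,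
    forall x, L x <= p x & forall c, C c -> L c.1 = c.2].
Proof.
move=> p_sub C0 C_lin C_le.
have C_cone a c c' : 0 <= a -> C c -> C c' ->
  C (a *: c.1 + c'.1, a * c.2 + c'.2) by move=> _; exact: C_lin.
have [q [q_sub qp0 q_min]] :=
  minimal_sublinear (cone_inf_sublinear p_sub C0 C_cone C_le).
have q_super x y : q x + q y <= q (x + y).
  pose D := [set c : V * R | exists2 t, 0 <= t & c = (t *: y, t * q y)].
  have D0 : D (0, 0) by exists 0; rewrite // scale0r mul0r.
  have D_cone a c c' : 0 <= a -> D c -> D c' ->
      D (a *: c.1 + c'.1, a * c.2 + c'.2).
    move=> a0 [t t0 ->] [t' t'0 ->]; exists (a * t + t').
      by rewrite addr_ge0 ?mulr_ge0.
    by rewrite /= scalerDl scalerA mulrDl mulrA.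
  have D_le c : D c -> c.2 <= q c.1.
    move=> [t t0 ->] /=; have [->|tn0] := eqVneq t 0.
      by rewrite scale0r mul0r q_sub.1.
    have t_gt0 : 0 < t by rewrite lt_neqAle eq_sym tn0.
    have := q_sub.2 t^-1 (t *: y) 0; rewrite invr_ge0 => /(_ t0).
    by rewrite scalerA mulVf// scale1r !addr0 q_sub.1 addr0 mulrC ler_pdivlMr// mulrC.
  have qD : cone_inf q D = q.
    apply: q_min; first exact: cone_inf_sublinear.
    by move=> z; have := cone_inf_le q_sub D_le z D0; rewrite /= addr0 subr0.
  have D1 : D (y, q y) by exists 1; rewrite // scale1r mul1r.
  by have := cone_inf_le q_sub D_le x D1; rewrite qD /= lerBrDr.
have q_add x y : q (x + y) = q x + q y.
  apply/eqP; rewrite eq_le q_super andbT.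
  by have := q_sub.2 1 x y ler01; rewrite scale1r mul1r.
have qN x : q (- x) = - q x.
  by apply/eqP; rewrite -addr_eq0 addrC -q_add subrr q_sub.1.
have qZ_le a x : 0 <= a -> q (a *: x) <= a * q x.
  by move=> a0; have := q_sub.2 a x 0 a0; rewrite !addr0 q_sub.1 addr0.
have qZ_ge0 a x : 0 <= a -> q (a *: x) = a * q x.
  move=> a0; apply/eqP; rewrite eq_le qZ_le//=.
  by rewrite -lerN2 -qN -scalerN -mulrN -qN qZ_le.
have qZ a x : q (a *: x) = a * q x.
  have [a0|a0] := leP 0 a; first exact: qZ_ge0.
  rewrite -[a]opprK scaleNr qN mulNr qZ_ge0//; lra.
have q_C c : C c -> c.2 <= q c.1.
  move=> Cc; rewrite -lerN2 -qN.
  apply: le_trans (qp0 _) _; apply: le_trans (cone_inf_le p_sub C_le _ Cc) _.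
  by rewrite addNr p_sub.1 sub0r.
exists q; split.
- by move=> a x y; rewrite q_add qZ.
- move=> x; apply: le_trans (qp0 x) _.
  by have := cone_inf_le p_sub C_le x C0; rewrite /= addr0 subr0.
- move=> c Cc; apply/eqP; rewrite eq_le q_C// andbT.
  have := q_C _ (C_lin (-1) _ _ Cc C0); rewrite /= !addr0 scaleN1r qN mulN1r; lra.
Qed.

End hahn_banach.
(** * Bounded linear functionals on integrable functions *)

Section integrable_real_functions.
Context d (T : measurableType d) (R : realType).
Variable mu : {measure set T -> \bar R}.
Implicit Types f g : T -> R.

Definition integrable_fun f := mu.-integrable setT (EFin \o f).

Lemma integrable_fun_lin (a : R) f g : integrable_fun f -> integrable_fun g ->
  integrable_fun (fun x => a * f x + g x).
Proof.
move=> If Ig; have := integrableD measurableT (integrableZl measurableT a If) Ig.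
by apply: eq_integrable.
Qed.

Lemma integrable_funZ (a : R) f : integrable_fun f ->
  integrable_fun (fun x => a * f x).
Proof.
by move=> If; have := integrableZl measurableT a If; apply: eq_integrable.
Qed.

Lemma integrable_fun_norm f : integrable_fun f -> integrable_fun (fun x => `|f x|).
Proof. exact: integrable_norm. Qed.

Lemma integrable_fun_measurable f : integrable_fun f -> measurable_fun setT f.
Proof. by move=> /measurable_int/measurable_EFinP. Qed.

Lemma dominated_cvg_L1 (f_ : nat -> T -> R) f g :
  (forall n, measurable_fun setT (f_ n)) -> measurable_fun setT f ->
  (forall x, f_ ^~ x @ \oo --> f x) -> integrable_fun g ->
  (forall n x, `|f_ n x| <= g x) ->
  integrable_fun f /\ (\int[mu]_x `|f_ n x - f x|) @[n --> \oo] --> (0 : R).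
Proof.
move=> mf_ mf f_f Ig f_g.
have [|||||If cvg0 _] := @dominated_convergence _ _ _ mu setT measurableT
  (fun n => EFin \o f_ n) (EFin \o f) (EFin \o g).
- by move=> n; exact/measurable_EFinP.
- exact/measurable_EFinP.
- by apply/aeW => x _; apply: cvg_EFin; [exact: nearW|exact: f_f].
- exact: Ig.
- by apply/aeW => x n _ /=; rewrite lee_fin.
split=> //; rewrite /Rintegral -[0]/(fine 0%E).
exact: fine_cvg.
Qed.

End integrable_real_functions.

Section L1_extension.
Context d (T : measurableType d) (R : realType).
Variable mu : {measure set T -> \bar R}.
Local Notation L1 := (integrable_fun mu).

(** The functional is extended on the vector space of integrable functions, not of
    their classes, and then to all functions by 0; linearity and the bound are
    only meaningful on integrable ones. *)
Lemma L1_extension (M : R) (C : set ((T -> R) * R)) : 0 <= M ->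
  (forall c, C c -> L1 c.1) -> C (fun=> 0, 0) ->
  (forall a c c', C c -> C c' ->
    C (fun x => a * c.1 x + c'.1 x, a * c.2 + c'.2)) ->
  (forall c, C c -> c.2 <= M * \int[mu]_x `|c.1 x|) ->
  exists L : (T -> R) -> R,
    [/\ forall a f g, L1 f -> L1 g -> L (fun x => a * f x + g x) = a * L f + L g,
      forall f, L1 f -> `|L f| <= M * \int[mu]_x `|f x| &
      forall c, C c -> L c.1 = c.2].
Proof.
move=> M0 C_L1 C0 C_lin C_le.
have p1 : (1 <= (1 : \bar R))%E by [].
pose V := LfunType mu p1.
have V_L1 (f : V) : L1 f by apply/Lfun1_integrable; exact: LfunP.
pose p (f : V) := M * \int[mu]_x `|f x|.
have p_sub : sublinear p.
  split.
    by rewrite /p /Rintegral; under eq_integral do rewrite normr0; rewrite integral0 mulr0.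
  move=> a f g a0; rewrite /p mulrCA -mulrDr; apply: ler_wpM2l => //.
  have If := integrable_fun_norm (V_L1 f); have Ig := integrable_fun_norm (V_L1 g).
  rewrite -RintegralZl// -RintegralD//; last exact: integrable_funZ.
  apply: le_Rintegral => //.
  - exact: integrable_fun_norm.
  - exact: integrable_fun_lin.
  - by move=> x _; rewrite (le_trans (ler_normD _ _))// normrM (ger0_norm a0).
pose C' := [set c : V * R | C (c.1 : T -> R, c.2)].
have [|||L [L_lin L_p L_C]] := @hahn_banach R V p C' p_sub.
- exact: C0.
- by move=> a c c' Cc Cc'; exact: (C_lin a _ _ Cc Cc').
- by move=> c Cc; exact: (C_le _ Cc).
have mk f : L1 f -> {F : V | F = f :> (T -> R)}.
  by move=> /Lfun1_integrable Hf; exists (Lfun_Sub p1 Hf).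
pose L' f := if pselect (L1 f) is left Hf then L (sval (mk f Hf)) else 0.
have L'E f (F : V) : F = f :> (T -> R) -> L' f = L F.
  move=> Ff; rewrite /L'; case: pselect => [Hf|]; last by rewrite -Ff => /(_ (V_L1 F)).
  by congr L; apply/LfuneqP => x; case: (mk f Hf) => G /= ->; rewrite Ff.
exists L'; split.
- move=> a f g /mk[F Ff] /mk[G Gg].
  rewrite (L'E _ _ Ff) (L'E _ _ Gg) -L_lin; apply: L'E.
  by rewrite -Ff -Gg.
- move=> f /mk[F Ff]; rewrite (L'E _ _ Ff) ler_norml.
  have -> : M * \int[mu]_x `|f x| = p F by rewrite -Ff.
  rewrite L_p andbT lerNl.
  have LN : L (- F) = - L F.
    have L0 : L 0 = 0 by have := L_lin 1 0 0; rewrite scale1r addr0 mul1r; lra.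
    by have := L_lin (-1) F 0; rewrite addr0 scaleN1r L0; lra.
  rewrite -LN; apply: le_trans (L_p _) _; rewrite /p; apply: ler_wpM2l => //.
  by under eq_Rintegral do rewrite normrN.
- move=> c Cc; have [F Fc] := mk _ (C_L1 _ Cc); rewrite (L'E _ _ Fc).
  by apply: (L_C (F, c.2)); rewrite /C' /= Fc -surjective_pairing.
Qed.

End L1_extension.
(** * The dual of L^1 *)

Section positive_weight.
Context d (T : measurableType d) (R : realType).
Variable mu : {sigma_finite_measure set T -> \bar R}.

(** The weight turns a sigma-finite measure into a finite one, which lets a
    functional on L^1 induce a finite charge. *)
Lemma positive_integrable_weight : exists w : T -> R,
  [/\ measurable_fun setT w, forall x, 0 < w x & integrable_fun mu w].
Proof.
have /sigma_finiteP[F [TF _ Foo]] := sigma_finiteT mu.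
(* The n-th coefficient makes the sum of the terms bounded by the geometric
   series, both pointwise and in L^1. *)
pose c n : R := (2 ^ n.+1)%:R^-1 / (1 + fine (mu (F n))).
have cD n : 0 < 1 + fine (mu (F n)) :> R.
  by rewrite ltr_pwDl// fine_ge0.
have c0 n : 0 < c n.
  by rewrite divr_gt0// invr_gt0 ltr0n expn_gt0.
have c_le n : c n <= (2 ^ n.+1)%:R^-1.
  by rewrite ler_pdivrMr// ler_peMr ?invr_ge0// lerDl fine_ge0.
pose u n x : \bar R := (c n * \1_(F n) x)%:E.
have u0 n x : (0 <= u n x)%E by rewrite lee_fin mulr_ge0// ltW.
have mu_ n : measurable_fun setT (u n).
  apply/measurable_EFinP; apply: measurable_funM => //.
  by apply: measurable_indic; case: (Foo n).
pose g x := (\sum_(n <oo) u n x)%E.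
have g_le x : (g x <= 1%:E)%E.
  apply: le_trans (@epsilon_trick0 R 1 xpredT ler01).
  apply: lee_nneseries => [n _ _|n _]; first exact: u0.
  rewrite lee_fin div1r; apply: le_trans (c_le n).
  by rewrite ler_piMr ?(ltW (c0 n))// indicE; case: (_ \in _).
have g_fin x : g x \is a fin_num.
  rewrite ge0_fin_numE; first exact: le_lt_trans (g_le x) (ltry _).
  by apply: nneseries_ge0.
have mg : measurable_fun setT g by apply: ge0_emeasurable_sum.
exists (fine \o g); split.
- by apply: measurableT_comp.
- move=> x /=; rewrite fine_gt0//; apply/andP; split; last first.
    exact: le_lt_trans (g_le x) (ltry _).
  have [n _ Fnx] : (\bigcup_i F i) x by rewrite -TF.
  apply: (@lt_le_trans _ _ (u n x)).
    by rewrite /u indicE mem_set// mulr1 lte_fin.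
  rewrite /g (nneseries_split 0 n.+1)//.
  apply: (@le_trans _ _ (\sum_(0 <= k < n.+1) u k x)%E).
    by rewrite big_nat_recr//= leeDr// sume_ge0.
  by rewrite leeDl// nneseries_ge0.
- apply/integrableP; split.
    by apply/measurable_EFinP; apply: measurableT_comp.
  rewrite (_ : (fun x => _) = g); last first.
    apply/funext => x /=; rewrite -[RHS]fineK// ger0_norm// fine_ge0//.
    exact: nneseries_ge0.
  rewrite integral_nneseries//.
  apply: le_lt_trans (ltry 1); apply: le_trans (@epsilon_trick0 R 1 xpredT ler01).
  apply: lee_nneseries => [n _ _|n _]; first exact: integral_ge0.
  have [mF Fn] := Foo n.
  rewrite /u; under eq_integral do rewrite EFinM.
  rewrite ge0_integralZl//; [|exact/measurable_EFinP/measurable_indic|by rewrite lee_fin ltW].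
  rewrite integral_indic// setIT div1r -[X in (_ * X)%E]fineK ?ge0_fin_numE//.
  rewrite -EFinM lee_fin /c -mulrA ler_piMr ?invr_ge0//.
  by rewrite ler_pdivrMl// mulr1 lerDr.
Qed.

End positive_weight.
Lemma measurable_fun_inv_gt0 d (T : measurableType d) (R : realType) (w : T -> R) :
  measurable_fun setT w -> (forall x, 0 < w x) ->
  measurable_fun setT (fun x => (w x)^-1).
Proof.
move=> mw w0; under eq_fun do rewrite -powR_inv1 ?(ltW (w0 _))//.
exact: (measurableT_comp (measurable_powR (-1)) mw).
Qed.

Section bounded_functional.
Import HBNNSimple.
Context d (T : measurableType d) (R : realType).
Variable mu : {sigma_finite_measure set T -> \bar R}.
Local Notation L1 := (integrable_fun mu).
Implicit Types (f g : T -> R) (L : (T -> R) -> R).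

Definition L1_bounded_linear (M : R) L :=
  (forall (a : R) f g, L1 f -> L1 g -> L (fun x => a * f x + g x) = a * L f + L g) /\
  (forall f, L1 f -> `|L f| <= M * \int[mu]_x `|f x|).

Lemma integrable_fun0 : L1 (fun=> 0).
Proof. exact: integrable0. Qed.

Section properties.
Variables (M : R) (L : (T -> R) -> R).
Hypothesis L_bl : L1_bounded_linear M L.

Lemma L1_bounded_linear0 : L (fun=> 0) = 0.
Proof.
have := L_bl.1 1 _ _ integrable_fun0 integrable_fun0.
rewrite (_ : (fun=> _) = fun=> 0); last by apply/funext => x; rewrite mulr0 addr0.
by rewrite mul1r; lra.
Qed.

Lemma L1_bounded_linearB f g : L1 f -> L1 g -> L (fun x => f x - g x) = L f - L g.
Proof.
move=> If Ig; have := L_bl.1 (-1) _ _ Ig If.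
rewrite (_ : (fun x => _) = fun x => f x - g x).
  by move=> ->; rewrite mulN1r addrC.
by apply/funext => x; rewrite mulN1r addrC.
Qed.

Lemma L1_bounded_linear_cvg (f_ : nat -> T -> R) f g :
  (forall n, measurable_fun setT (f_ n)) -> measurable_fun setT f ->
  (forall x, f_ ^~ x @ \oo --> f x) -> L1 g ->
  (forall n x, `|f_ n x| <= g x) ->
  L (f_ n) @[n --> \oo] --> L f.
Proof.
move=> mf_ mf f_f Ig f_g.
have [If cvg0] := dominated_cvg_L1 mf_ mf f_f Ig f_g.
have If_ n : L1 (f_ n).
  apply: le_integrable Ig => //; first exact/measurable_EFinP.
  by move=> x _ /=; rewrite lee_fin (le_trans (f_g n x))// ler_norm.
apply/subr_cvg0/norm_cvg0P.
have cvgM : M * \int[mu]_x `|f_ n x - f x| @[n --> \oo] --> (0 : R).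
  by rewrite -[X in _ --> X](mulr0 M); apply: cvgMr.
apply: squeeze_cvgr (cvg_cst 0) cvgM; apply: nearW => n.
rewrite normr_ge0/= -L1_bounded_linearB//; apply: L_bl.2.
by have := integrable_fun_lin (-1) If (If_ n); apply: eq_integrable => // x _ /=;
  rewrite mulN1r addrC.
Qed.

Lemma L1_bounded_linear_sum (I : Type) (s : seq I) (a : I -> R) (F : I -> T -> R) :
  (forall i, L1 (F i)) ->
  L1 (fun x => \sum_(i <- s) a i * F i x) /\
  L (fun x => \sum_(i <- s) a i * F i x) = \sum_(i <- s) a i * L (F i).
Proof.
move=> IF; elim: s => [|i s [Is IH]].
  rewrite big_nil (_ : (fun x => _) = fun=> 0); last by apply/funext => x; rewrite big_nil.
  by split; [exact: integrable_fun0|exact: L1_bounded_linear0].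
rewrite (_ : (fun x => _) = fun x => a i * F i x + \sum_(j <- s) a j * F j x); last first.
  by apply/funext => x; rewrite big_cons.
split; first exact: integrable_fun_lin.
by rewrite big_cons L_bl.1// IH.
Qed.

End properties.

Lemma integrable_fun_indic w A : L1 w -> measurable A -> L1 (fun x => w x * \1_A x).
Proof.
move=> Iw mA; apply: (le_integrable measurableT _ _ Iw) => //.
  apply/measurable_EFinP; apply: measurable_funM => //.
  exact: integrable_fun_measurable Iw.
move=> x _ /=; rewrite lee_fin normrM ler_piMr// indicE.
by case: (_ \in _); rewrite ?normr1// normr0.
Qed.

(** For f >= 0, the function f / w is an increasing limit of simple functions h_n,
    and w h_n tends to f while being dominated by f. *)
Lemma L1_bounded_linear_eq0 M L w : L1_bounded_linear M L ->
  L1 w -> (forall x, 0 < w x) ->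
  (forall A, measurable A -> L (fun x => w x * \1_A x) = 0) ->
  forall f, L1 f -> L f = 0.
Proof.
move=> L_bl Iw w0 Lw.
have mw := integrable_fun_measurable Iw.
have ge0_case f : L1 f -> (forall x, 0 <= f x) -> L f = 0.
  move=> If f0; have mf := integrable_fun_measurable If.
  pose h x := f x * (w x)^-1.
  have mh : measurable_fun setT h.
    apply: measurable_funM => //; exact: measurable_fun_inv_gt0.
  have mEh : measurable_fun setT (EFin \o h) by exact/measurable_EFinP.
  have h0 x : setT x -> (0 <= (EFin \o h) x)%E.
    by move=> _; rewrite lee_fin mulr_ge0// invr_ge0 ltW.
  pose h_ n : T -> R := nnsfun_approx measurableT mEh n.
  have mh_ n : measurable_fun setT (h_ n) by exact: measurable_funP.
  have h_h x : h_ n x @[n --> \oo] --> h x.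
    by have /fine_cvg := cvg_nnsfun_approx measurableT mEh h0 (I : setT x).
  have h_0 n x : 0 <= h_ n x by exact: fun_ge0.
  have h_le n x : h_ n x <= h x.
    rewrite -(cvg_lim (@Rhausdorff R) (h_h x)).
    apply: nondecreasing_cvgn_le; last by apply/cvg_ex; exists (h x); exact: h_h.
    by move=> i j ij; have /lefP := nd_nnsfun_approx measurableT mEh ij; exact.
  have wh x : w x * h x = f x by rewrite mulrCA mulfV ?mulr1// gt_eqF.
  have Lh n : L (fun x => w x * h_ n x) = 0.
    pose s := finmap.enum_fset (fset_set (range (h_ n))).
    have -> : (fun x => w x * h_ n x) =
        fun x => \sum_(y <- s) y * (w x * \1_(h_ n @^-1` [set y]) x).
      apply/funext => x; rewrite /h_ {1}fimfunE fsbig_finite/=; last exact: fimfunP.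
      by rewrite mulr_sumr; apply: eq_bigr => y _; rewrite mulrCA.
    have mA (y : R) : measurable (h_ n @^-1` [set y]).
      by rewrite -[X in measurable X]setTI; exact: mh_.
    have [_ ->] := L1_bounded_linear_sum L_bl s id
      (fun y => integrable_fun_indic Iw (mA y)).
    by rewrite big1// => y _; rewrite Lw ?mulr0.
  have : L (fun x => w x * h_ n x) @[n --> \oo] --> L f.
    apply: (L1_bounded_linear_cvg L_bl (g := f)) => //.
    - by move=> n; exact: measurable_funM.
    - move=> x; rewrite -(wh x); apply: cvgMr; exact: h_h.
    - move=> n x; rewrite normrM !ger0_norm// ?(ltW (w0 x))//.
      by rewrite -(wh x) ler_wpM2l// ltW.
  under eq_cvg do rewrite Lh.
  by move=> /(cvg_unique _ (cvg_cst 0)) => /(_ (@Rhausdorff R)).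
move=> f If.
have mf := integrable_fun_measurable If.
have Ip : L1 (fun x => Num.max (f x) 0) by exact: (integrable_funrpos _ If).
have In : L1 (fun x => Num.max (- f x) 0) by exact: (integrable_funrneg _ If).
have -> : f = (fun x => Num.max (f x) 0 - Num.max (- f x) 0).
  by apply/funext => x; case: (leP (f x) 0) => ?; case: (leP (- f x) 0) => ?; lra.
rewrite (L1_bounded_linearB L_bl)// !ge0_case ?subrr// => x;
  by rewrite le_max lexx orbT.
Qed.

(** Test with the set where f is positive. *)
Lemma ae_le0 f : L1 f ->
  (forall A, measurable A -> \int[mu]_x (f x * \1_A x) <= 0) ->
  {ae mu, forall x, f x <= 0}.
Proof.
move=> If f_le; have mf := integrable_fun_measurable If.
pose A := [set x | 0 < f x].
have mA : measurable A.
  rewrite /A -[X in measurable X]setTI.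
  rewrite (_ : [set x | 0 < f x] = f @^-1` `]0, +oo[%classic); last first.
    by apply/seteqP; split => x /=; rewrite in_itv/= andbT.
  exact: mf.
have fA x : 0 <= f x * \1_A x.
  rewrite indicE; case: (boolP (x \in A)); rewrite ?mulr0// inE /A /= mulr1.
  exact: ltW.
have IfA := integrable_fun_indic If mA.
have : \int[mu]_x (f x * \1_A x) = 0.
  by apply/eqP; rewrite eq_le f_le//= Rintegral_ge0.
rewrite /Rintegral => int0.
have int0' : (\int[mu]_x `|(f x * \1_A x)%:E|)%E = 0%E.
  under eq_integral do rewrite gee0_abs ?lee_fin//.
  by rewrite -[LHS]fineK ?int0//; exact: integrable_fin_num.
have mfA := measurable_int _ IfA.
have [N [mN N0 sN]] := (ae_eq_integral_abs mu measurableT mfA).1 int0'.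
exists N; split => // x /= fx; apply: sN => /= /(_ I) -[].
rewrite indicE mem_set; last by rewrite /A /= ltNge; apply/negP.
by rewrite mulr1 => fx0; apply: fx; rewrite fx0.
Qed.

End bounded_functional.
Section weighted_charge.
Context d (T : measurableType d) (R : realType).
Variable mu : {sigma_finite_measure set T -> \bar R}.
Variables (M : R) (L : (T -> R) -> R) (w : T -> R).
Hypotheses (L_bl : L1_bounded_linear mu M L) (Iw : integrable_fun mu w).
Hypothesis w_gt0 : forall x, 0 < w x.

Definition weighted_charge (A : set T) : \bar R := (L (fun x => w x * \1_A x))%:E.

Let weighted_charge0 : weighted_charge set0 = 0%E.
Proof.
rewrite /weighted_charge (_ : (fun x => _) = fun=> 0).
  by rewrite (L1_bounded_linear0 L_bl).
by apply/funext => x; rewrite indic0 mulr0.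
Qed.

Let weighted_charge_finite A : measurable A -> weighted_charge A \is a fin_num.
Proof. by []. Qed.

Let weighted_charge_sigma_additive : semi_sigma_additive weighted_charge.
Proof.
move=> F mF tF mUF; have mw := integrable_fun_measurable Iw.
pose S n x : R := \sum_(i < n) \1_(F i) x.
have sumE n : (\sum_(0 <= i < n) weighted_charge (F i))%E = (L (fun x => w x * S n x))%:E.
  rewrite big_mkord sumEFin; congr EFin.
  have [_] := L1_bounded_linear_sum L_bl (index_enum 'I_n)
    (fun=> 1) (fun i => integrable_fun_indic Iw (mF i)).
  under [RHS]eq_bigr do rewrite mul1r.
  move=> <-; congr L; apply/funext => x.
  by rewrite /S mulr_sumr; apply: eq_bigr => i _; rewrite mul1r.
have SE n x : (S n x)%:E = (\sum_(0 <= i < n) (\1_(F i) x)%:E)%E.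
  by rewrite big_mkord sumEFin.
have S_le n x : 0 <= S n x <= 1.
  rewrite sumr_ge0//= -lee_fin SE.
  apply: (@le_trans _ _ (\1_(\bigcup_i F i) x)%:E); last first.
    by rewrite lee_fin indicE; case: (_ \in _).
  by rewrite indic_bigcup//; apply: nneseries_lim_ge => k _; rewrite lee_fin.
have S_cvg x : S n x @[n --> \oo] --> (\1_(\bigcup_i F i) x : R).
  suff /fine_cvg : (S n x)%:E @[n --> \oo] --> (\1_(\bigcup_i F i) x : R)%:E by [].
  under eq_fun do rewrite SE.
  by rewrite indic_bigcup//; apply: is_cvg_nneseries => k _ _; rewrite lee_fin.
under eq_fun do rewrite sumE.
apply: cvg_EFin; first exact: nearW.
apply: (L1_bounded_linear_cvg L_bl (g := w)) => //.
- move=> n; apply: measurable_funM => //; apply: measurable_sum => i.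
  exact: measurable_indic.
- by apply: measurable_funM => //; exact: measurable_indic.
- by move=> x; apply: cvgMr; exact: S_cvg.
- move=> n x; have /andP[S0 S1] := S_le n x.
  by rewrite ger0_norm ?mulr_ge0 ?(ltW (w_gt0 x))// ler_piMr// ltW.
Qed.

HB.instance Definition _ := isCharge.Build _ T R weighted_charge
  weighted_charge0 weighted_charge_finite weighted_charge_sigma_additive.

Lemma weighted_charge_dominates : weighted_charge `<< mu.
Proof.
apply/null_content_dominatesP => A mA A0; rewrite /weighted_charge; congr EFin.
apply/eqP; rewrite -normr_le0; apply: le_trans (L_bl.2 _ (integrable_fun_indic Iw mA)) _.
rewrite (_ : \int[mu]_x _ = 0) ?mulr0//.
rewrite /Rintegral (_ : integral _ _ _ = \int[mu]_(x in A) (w x)%:E)%E; last first.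
  rewrite [RHS]integral_mkcond; apply: eq_integral => x _.
  rewrite patchE indicE; case: (x \in A); rewrite ?mulr1 ?mulr0 ?normr0//.
  by rewrite ger0_norm// ltW.
by rewrite null_set_integral//; apply: measurable_funTS; exact: measurable_int Iw.
Qed.

(** Radon-Nikodym: the functional seen on the functions w 1_A is a charge that
    vanishes on negligible sets. *)
Lemma weighted_charge_density : exists g : T -> R, integrable_fun mu g /\
  forall A, measurable A -> L (fun x => w x * \1_A x) = \int[mu]_x (g x * \1_A x).
Proof.
pose nu : {charge set T -> \bar R} := weighted_charge.
have nu_mu : nu `<< mu by exact: weighted_charge_dominates.
exists (fine \o Radon_Nikodym nu mu); split.
  apply: eq_integrable (Radon_Nikodym_integrable nu_mu) => // x _ /=.
  by rewrite fineK// Radon_Nikodym_fin_num.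
move=> A mA; have := Radon_Nikodym_integral nu_mu mA.
move=> /(congr1 fine); rewrite /Rintegral /nu /= => ->.
congr fine; rewrite integral_mkcond; apply: eq_integral => x _.
rewrite patchE indicE; case: (x \in A); rewrite ?mulr1 ?mulr0//=.
by rewrite fineK// Radon_Nikodym_fin_num.
Qed.

End weighted_charge.

Section L1_dual.
Context d (T : measurableType d) (R : realType).
Variable mu : {sigma_finite_measure set T -> \bar R}.

(** If g is the density of A |-> L (w 1_A), the representing function is g / w;
    testing g against sets shows |g| <= M w almost everywhere, so g / w can be
    truncated at M without changing its class.  The difference between L and
    integration against phi then vanishes on all w 1_A, hence everywhere. *)
Theorem L1_dual (M : R) L : 0 <= M -> L1_bounded_linear mu M L ->
  exists phi : T -> R, [/\ measurable_fun setT phi, forall x, `|phi x| <= M &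
    forall f, integrable_fun mu f -> L f = \int[mu]_x (phi x * f x)].
Proof.
move=> M0 L_bl; have [w [mw w0 Iw]] := positive_integrable_weight mu.
have [g [Ig gE]] := weighted_charge_density L_bl Iw w0.
have mg := integrable_fun_measurable Ig.
have half (s : R) : `|s| = 1 -> {ae mu, forall x, s * g x - M * w x <= 0}.
  move=> s1; have Isg : integrable_fun mu (fun x => s * g x - M * w x).
    have := integrable_fun_lin s Ig (integrable_funZ (- M) Iw).
    by apply: eq_integrable => // x _ /=; rewrite mulNr.
  apply: ae_le0 => // A mA.
  have IgA := integrable_fun_indic Ig mA; have IwA := integrable_fun_indic Iw mA.
  under eq_Rintegral do rewrite mulrBl -!mulrA.
  rewrite RintegralB//; try exact: integrable_funZ.
  rewrite !RintegralZl// -gE// subr_le0.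
  apply: le_trans (ler_norm _) _; rewrite normrM s1 mul1r.
  apply: le_trans (L_bl.2 _ IwA) _.
  rewrite ler_wpM2l// le_Rintegral//; first exact: integrable_fun_norm.
  by move=> x _; rewrite ger0_norm// mulr_ge0// ltW.
pose phi x := Num.max (- M) (Num.min M (g x * (w x)^-1)).
have mphi : measurable_fun setT phi.
  apply: measurable_maxr => //; apply: measurable_minr => //.
  by apply: measurable_funM => //; exact: measurable_fun_inv_gt0.
have phi_le x : `|phi x| <= M.
  rewrite ler_norml /phi le_max lexx/= ge_max ge_min lexx/= andbT; lra.
have phi_w : {ae mu, forall x, phi x * w x = g x}.
  have := half 1 (normr1 _); have := half (-1) (normrN1 _).
  apply: filterS2 => x h1 h2.
  have wx := w0 x; rewrite /phi min_r; last by rewrite ler_pdivrMr//; lra.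
  by rewrite max_r ?divfK ?gt_eqF// ler_pdivlMr//; lra.
have Iphi f : integrable_fun mu f -> integrable_fun mu (fun x => phi x * f x).
  move=> If; apply: (integrableMr measurableT mphi _ If).
  exists M; split; first exact: num_real.
  by move=> r Mr x _; exact: le_trans (phi_le x) (ltW Mr).
exists phi; split => // f If; apply/eqP; rewrite -subr_eq0; apply/eqP.
pose D f := L f - \int[mu]_x (phi x * f x).
apply: (@L1_bounded_linear_eq0 _ _ _ mu (M + M) D w) => //.
- split=> [a f1 f2 If1 If2|f1 If1].
    rewrite /D L_bl.1// (_ : \int[mu]_x _ =
      a * (\int[mu]_x (phi x * f1 x)) + \int[mu]_x (phi x * f2 x)); first by ring.
    under eq_Rintegral do rewrite mulrDr mulrCA.
    rewrite RintegralD ?RintegralZl//; try exact: Iphi.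
    by apply: integrable_funZ; exact: Iphi.
  rewrite /D (le_trans (ler_normB _ _))// mulrDl lerD//; first exact: L_bl.2.
  apply: le_trans (le_normr_Rintegral _ (Iphi _ If1)) _ => //.
  rewrite -RintegralZl//; last exact: integrable_fun_norm.
  apply: le_Rintegral => //.
  + by apply: integrable_fun_norm; exact: Iphi.
  + by apply: integrable_funZ; exact: integrable_fun_norm.
  + by move=> x _; rewrite normrM ler_wpM2r.
- move=> A mA; rewrite /D gE//; apply/eqP; rewrite subr_eq0; apply/eqP.
  congr fine; apply: ae_eq_integral => //.
  + by apply: measurable_int; exact: integrable_fun_indic Ig mA.
  + by apply: measurable_int; apply: Iphi; exact: integrable_fun_indic Iw mA.
  + by apply: filterS phi_w => x + _ /=; rewrite mulrA => ->.
Qed.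

End L1_dual.
(** * Borel sets and continuous functions on R^n and R x R^n *)

Section row_vectors.
Context {R : realType}.

Lemma coord_le_norm n (x : 'rV[R]_n) i : `|x ord0 i| <= `|x|.
Proof.
rewrite [leRHS]/Num.Def.normr /= mx_normrE; apply/bigmax_geP; right => /=.
by exists (ord0, i).
Qed.

Lemma norm_rV_le n (x : 'rV[R]_n) r : 0 <= r ->
  (forall i, `|x ord0 i| <= r) -> `|x| <= r.
Proof.
move=> r0 xr; rewrite [leLHS]/Num.Def.normr /= mx_normrE.
apply/bigmax_leP; split => // -[i j] _ /=.
by rewrite ord1.
Qed.

Lemma norm_rV_lt n (x : 'rV[R]_n) r : 0 < r ->
  (forall i, `|x ord0 i| < r) -> `|x| < r.
Proof.
move=> r0 xr; rewrite [ltLHS]/Num.Def.normr /= mx_normrE.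
apply/bigmax_ltP; split => // -[i j] _ /=.
by rewrite ord1.
Qed.

(** Half-open cubes of side 1 / (k + 1); for fixed k they partition R^n. *)
Definition grid_cell n (k : nat) (c : 'rV[int]_n) : set 'rV[R]_n :=
  [set x | forall i, (c ord0 i)%:~R <= x ord0 i * k.+1%:R < (c ord0 i + 1)%:~R].

Lemma measurable_grid_cell n k (c : 'rV[int]_n) : measurable (grid_cell k c).
Proof.
rewrite [X in measurable X](_ : _ = \bigcap_(i in [set: 'I_n])
    ((fun x : 'rV[R]_n => x ord0 i) @^-1`
       `[(c ord0 i)%:~R / k.+1%:R, (c ord0 i + 1)%:~R / k.+1%:R[)); last first.
  apply/seteqP; split => [x cx i _|x cx i]; [have := cx i|have := cx i I];
    by rewrite /= in_itv/= ler_pdivrMr// ltr_pdivlMr.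
apply: fin_bigcap_measurable => // i _.
by rewrite -[X in measurable X]setTI; apply: measurable_rV_coord.
Qed.

(** An open set is the union of the countably many grid cells that it contains. *)
Lemma open_measurable_rV n (U : set 'rV[R]_n) : open U -> measurable U.
Proof.
move=> oU; pose I := (nat * 'rV[int]_n)%type.
pose F (kc : I) := [set x | grid_cell kc.1 kc.2 x /\ grid_cell kc.1 kc.2 `<=` U].
have -> : U = \bigcup_kc F kc.
  apply/seteqP; split => [x Ux|x [kc _ [cx cU]]]; last exact: cU.
  have /nbhs_ballP[e /= e0 eU] : nbhs x U by exact: open_nbhs_nbhs.
  have [k ke] := ltr_add_invr e0; rewrite add0r in ke.
  pose c : 'rV[int]_n := \row_i Num.floor (x ord0 i * k.+1%:R).
  have cx : grid_cell k c x by move=> i; rewrite mxE; exact: floor_itv.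
  exists (k, c) => //; split => // y cy; apply: eU.
  rewrite -ball_normE /=; apply: norm_rV_lt => // i; apply: le_lt_trans ke.
  have k0 : 0 < k.+1%:R :> R by rewrite ltr0n.
  rewrite -[leRHS]mul1r ler_pdivlMr// !mxE.
  have := cx i; have := cy i; rewrite /= intrD => /andP[y1 y2] /andP[x1 x2].
  rewrite -[X in `|_| * X]ger0_norm ?ler0n// -normrM mulrBl ler_norml.
  by apply/andP; split; lra.
apply: countable_bigcupT_measurable => [|[k c]]; first exact: countableP.
have [cU|ncU] := pselect (grid_cell k c `<=` U).
  rewrite (_ : F _ = grid_cell k c); first exact: measurable_grid_cell.
  by apply/seteqP; split => x; [case|split].
by rewrite (_ : F _ = set0)//; apply/seteqP; split => x // -[].
Qed.

Lemma closed_measurable_rV n (A : set 'rV[R]_n) : closed A -> measurable A.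
Proof.
move=> cA; rewrite -(setCK A); apply: measurableC.
by apply: open_measurable_rV; exact: closed_openC.
Qed.

Lemma continuous_measurable_rV n (f : 'rV[R]_n -> R) : continuous f ->
  measurable_fun setT f.
Proof.
move=> /continuousP cf.
apply: (measurability _ (RGenOpens.measurableE R)) => _ [_ [a [b ->] <-]].
by rewrite setTI; apply: open_measurable_rV; apply: cf; exact: interval_open.
Qed.

(** R x R^n and R^(n+1) are identified by isometries, under which the product
    measure and the Lebesgue measure correspond by definition; statements on
    R x R^n are deduced from those on R^(n+1). *)
Definition uncons_rV n (x : 'rV[R]_n.+1) : R * 'rV[R]_n :=
  (x ord0 ord0, \row_j x ord0 (lift ord0 j)).

Lemma cons_rVK n : cancel (@cons_rV R n) (@uncons_rV n).
Proof.
move=> [a b]; rewrite /uncons_rV /cons_rV /= mxE unlift_none; congr pair.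
by apply/rowP => j; rewrite !mxE liftK.
Qed.

Lemma norm_uncons_rV n (x : 'rV[R]_n.+1) : `|uncons_rV x| = `|x|.
Proof.
rewrite prod_normE /=; apply/eqP; rewrite eq_le; apply/andP; split.
  rewrite ge_max coord_le_norm /=; apply: norm_rV_le => // i.
  by rewrite mxE coord_le_norm.
apply: norm_rV_le => [|i]; first by rewrite le_max normr_ge0.
case: (unliftP ord0 i) => [j ->|->]; rewrite le_max ?lexx//.
have := coord_le_norm (\row_j x ord0 (lift ord0 j)) j.
by rewrite mxE => ->; rewrite orbT.
Qed.

Lemma norm_cons_rV n (z : R * 'rV[R]_n) : `|cons_rV z| = `|z|.
Proof. by rewrite -norm_uncons_rV cons_rVK. Qed.

Lemma continuous_isometry (V W : normedModType R) (f : V -> W) :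
  (forall x y, f (x - y) = f x - f y) -> (forall x, `|f x| = `|x|) -> continuous f.
Proof.
move=> fB fN x; apply/cvgrPdist_lt => e e0; near=> y.
rewrite -fB fN; near: y; by apply: cvgr_dist_lt => //; exact: cvg_id.
Unshelve. all: by end_near. Qed.

Lemma continuous_cons_rV n : continuous (@cons_rV R n : R * 'rV[R]_n -> 'rV[R]_n.+1).
Proof.
apply: continuous_isometry => [[a x] [b y]|z]; last exact: norm_cons_rV.
by apply/rowP => i; rewrite !mxE /=; case: unlift => [j|//]; rewrite !mxE.
Qed.

Lemma continuous_uncons_rV n : continuous (@uncons_rV n).
Proof.
apply: continuous_isometry => [x y|z]; last exact: norm_uncons_rV.
by rewrite /uncons_rV; congr pair; [rewrite !mxE|apply/rowP => i; rewrite !mxE].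
Qed.

Lemma continuous_measurable_prod n (f : R * 'rV[R]_n -> R) : continuous f ->
  measurable_fun setT (f : measurableTypeR R * 'rV[R]_n -> R).
Proof.
move=> cf; rewrite (_ : f = (f \o @uncons_rV n) \o @cons_rV R n); last first.
  by apply/funext => z /=; rewrite cons_rVK.
apply: measurableT_comp; last exact: measurable_cons_rV.
apply: continuous_measurable_rV => x.
by apply: continuous_comp; [exact: continuous_uncons_rV|exact: cf].
Qed.

Lemma closed_measurable_prod n (A : set (R * 'rV[R]_n)) : closed A ->
  measurable (A : set (measurableTypeR R * 'rV[R]_n)).
Proof.
move=> cA; rewrite (_ : A = @cons_rV R n @^-1` (@uncons_rV n @^-1` A)); last first.
  by rewrite -comp_preimage (_ : _ \o _ = id)//; apply/funext => z; exact: cons_rVK.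
rewrite -[X in measurable X]setTI; apply: measurable_cons_rV => //.
apply: closed_measurable_rV; apply: closed_comp => // x _.
exact: continuous_uncons_rV.
Qed.

End row_vectors.
Section compact_support.
Context {R : realType} {V : normedModType R}.
Implicit Types f g : V -> R.

(** Supports are controlled by the norm: this passes to derivatives and to slices
    without any topology, and in finite dimension is the same as compactness of
    the support. *)
Definition supported_in (B : R) f := forall z, B < `|z| -> f z = 0.

Definition continuous_csupp f := continuous f /\ exists B, supported_in B f.

Definition closed_norm_ball (B : R) : set V := [set z | `|z| <= B].

Lemma closed_closed_norm_ball B : closed (closed_norm_ball B).
Proof.
rewrite /closed_norm_ball (_ : [set z | _] = (fun z : V => `|z|) @^-1` [set x : R | x <= B])//.
by apply: closed_comp => [x _|]; [exact: norm_continuous|exact: closed_le].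
Qed.

Lemma supported_in_support f : compact (closure [set x | f x != 0]) ->
  exists B, supported_in B f.
Proof.
move=> /compact_bounded[M [_ Mb]]; exists (M + 1) => z zM.
apply: contrapT => /eqP fz0; have : `|z| <= M + 1.
  by apply: (Mb (M + 1)); [rewrite ltrDl|exact: subset_closure].
by rewrite leNgt zM.
Qed.

Lemma support_supported_in f B : compact (closed_norm_ball B) ->
  supported_in B f -> compact (closure [set x | f x != 0]).
Proof.
move=> cB fB; apply: (subclosed_compact _ cB); first exact: closed_closure.
rewrite [X in _ `<=` X](closure_id _).1; last exact: closed_closed_norm_ball.
apply: closure_subset => z /= fz0; rewrite /closed_norm_ball /= leNgt.
by apply/negP => /fB fz; rewrite fz eqxx in fz0.
Qed.

Lemma supported_in_derive f B w : supported_in B f -> supported_in B ('D_w f).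
Proof.
move=> fB z zB; rewrite (@near_eq_derive _ _ _ f (cst 0)); first exact: derive_cst.
near=> y; apply: fB; near: y.
have /(_ z) cN : continuous (fun z : V => `|z|) by exact: norm_continuous.
exact: (cvgr_gt _ cN).
Unshelve. all: by end_near. Qed.

Lemma bounded_continuous_csupp f B : compact (closed_norm_ball B) ->
  continuous f -> supported_in B f -> exists2 M : R, 0 <= M & forall z, `|f z| <= M.
Proof.
move=> cB cf fB; have := @continuous_compact _ _ f (closed_norm_ball B) _ cB.
move=> /(_ (continuous_subspaceT cf))/compact_bounded[M [_ Mb]].
exists (`|M| + 1) => [|z]; first by rewrite addr_ge0.
have [zB|zB] := leP `|z| B; last by rewrite fB// normr0 addr_ge0.
apply: (Mb (`|M| + 1)); last by exists z.
by rewrite (le_lt_trans (ler_norm M))// ltrDl.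
Qed.

End compact_support.

Section compact_balls.
Context {R : realType}.

Lemma compact_ball_rV n B : compact (@closed_norm_ball R 'rV[R]_n B).
Proof.
apply: bounded_closed_compact; last exact: closed_closed_norm_ball.
exists B; split; first exact: num_real.
by move=> z Bz x xB; exact: le_trans xB (ltW Bz).
Qed.

Lemma compact_ball_prod n B : compact (@closed_norm_ball R (R * 'rV[R]_n)%type B).
Proof.
have c1 : compact (`[- B, B]%classic : set R) by exact: segment_compact.
apply: (subclosed_compact _ (compact_setX c1 (@compact_ball_rV n B))).
  exact: closed_closed_norm_ball.
move=> [a x]; rewrite /closed_norm_ball /= prod_normE ge_max /= => /andP[aB xB].
by split => //=; rewrite in_itv/= -ler_norml.
Qed.

Lemma measure_ball_rV n B :
  (lebesgue_measure_rV n (@closed_norm_ball R 'rV[R]_n B) < +oo)%E.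
Proof.
pose A (i : 'I_n) : set (measurableTypeR R) := `[- B, B]%classic.
have mA i : measurable (A i) by exact: measurable_itv.
apply: (@le_lt_trans _ _ (lebesgue_measure_rV n [set x | forall i, A i (x ord0 i)])).
  apply: le_measure; rewrite ?inE.
  - by apply: closed_measurable_rV; exact: closed_closed_norm_ball.
  - apply: closed_measurable_rV.
    rewrite [X in closed X](_ : _ = \bigcap_(i in [set: 'I_n])
      ((fun x : 'rV[R]_n => x ord0 i) @^-1` A i)).
      apply: closed_bigI => i _; apply: closed_comp => [x _|]; last exact: itv_closed.
      exact: coord_continuous.
    by apply/seteqP; split => [x h i _|x h i]; [exact: h|exact: (h i I)].
  - move=> x xB i; rewrite /A /= in_itv/= -ler_norml.
    exact: le_trans (coord_le_norm x i) xB.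
rewrite lebesgue_measure_rV_box//.
suff : (\prod_(i < n) lebesgue_measure (A i))%E \is a fin_num by move=> /fin_numPlt/andP[].
elim/big_ind: _ => // [x y xfin yfin|i _]; first exact: fin_numM.
by rewrite /A lebesgue_measure_itv /=; case: ifP.
Qed.

Lemma measure_ball_prod n B :
  ((lebesgue_measure \x lebesgue_measure_rV n)%E
     (@closed_norm_ball R (R * 'rV[R]_n)%type B) < +oo)%E.
Proof.
rewrite (_ : closed_norm_ball B = @cons_rV R n @^-1` closed_norm_ball B).
  exact: (measure_ball_rV n.+1 B).
by apply/seteqP; split => z; rewrite /closed_norm_ball /= norm_cons_rV.
Qed.

Lemma integrable_supported d (T : measurableType d) (mu : {measure set T -> \bar R})
    (f : T -> R) (A : set T) M : measurable A -> (mu A < +oo)%E ->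
  measurable_fun setT f -> (forall x, `|f x| <= M) -> (forall x, ~ A x -> f x = 0) ->
  integrable_fun mu f.
Proof.
move=> mA Aoo mf fM fA; have /integrable_mkcond : mu.-integrable A (EFin \o f).
  apply: measurable_bounded_integrable => //; first exact: measurable_funTS.
  exists M; split; first exact: num_real.
  by move=> r Mr x _; exact: le_trans (fM x) (ltW Mr).
move=> /(_ mA); apply: eq_integrable => // x _.
by rewrite patchE; case: ifPn => // /negP xA; rewrite /= fA// => Ax; apply: xA; rewrite inE.
Qed.

Lemma integrable_continuous_rV n (f : 'rV[R]_n -> R) : continuous_csupp f ->
  integrable_fun (lebesgue_measure_rV n) f.
Proof.
move=> [cf [B fB]].
have [M M0 fM] := bounded_continuous_csupp (@compact_ball_rV n B) cf fB.
apply: (@integrable_supported _ 'rV[R]_n (lebesgue_measure_rV n) f (closed_norm_ball B) M).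
- by apply: closed_measurable_rV; exact: closed_closed_norm_ball.
- exact: measure_ball_rV.
- exact: continuous_measurable_rV.
- exact: fM.
- by move=> x /negP; rewrite -ltNge; exact: fB.
Qed.

Lemma integrable_continuous_prod n (f : R * 'rV[R]_n -> R) : continuous_csupp f ->
  integrable_fun (lebesgue_measure \x lebesgue_measure_rV n)%E f.
Proof.
move=> [cf [B fB]].
have [M M0 fM] := bounded_continuous_csupp (@compact_ball_prod n B) cf fB.
apply: (@integrable_supported _ (measurableTypeR R * 'rV[R]_n)%type
  (lebesgue_measure \x lebesgue_measure_rV n)%E f (closed_norm_ball B) M).
- by apply: closed_measurable_prod; exact: closed_closed_norm_ball.
- exact: measure_ball_prod.
- exact: continuous_measurable_prod.
- exact: fM.
- by move=> x /negP; rewrite -ltNge; exact: fB.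
Qed.

End compact_balls.
(** * Smooth functions *)

Section directional_derivative.
Context {R : realType}.

(** A directional derivative only depends on the restriction to a line.  This
    relates derivatives on R x R^n to those of slices and on R^(n+1), and reduces
    the chain rule to one variable. *)
Lemma derive_same_line (V W : normedModType R) (f : V -> R) (g : W -> R) x v y w :
  (forall h : R, f (h *: v + x) = g (h *: w + y)) ->
  (derivable f x v <-> derivable g y w) /\ 'D_v f x = 'D_w g y.
Proof.
move=> fg; have fg0 : f x = g y by have := fg 0; rewrite !scale0r !add0r.
suff E : (fun h : R => h^-1 *: ((f \o shift x) (h *: v) - f x)) =
    (fun h => h^-1 *: ((g \o shift y) (h *: w) - g y)).
  by rewrite /derivable /derive E.
by apply/funext => h /=; rewrite fg fg0.
Qed.

Lemma is_derive_same_line (V W : normedModType R) (f : V -> R) (g : W -> R) x v y w l :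
  (forall h : R, f (h *: v + x) = g (h *: w + y)) ->
  is_derive x v f l -> is_derive y w g l.
Proof.
move=> /derive_same_line[dfg fg] [df fl]; split; first exact: dfg.1.
by rewrite -fg.
Qed.

Lemma is_derive_comp1 (V : normedModType R) (phi : R -> R) (f : V -> R) x v a l :
  is_derive (f x) 1 phi a -> is_derive x v f l -> is_derive x v (phi \o f) (a * l).
Proof.
move=> dphi df; pose u (s : R) := f (s *: v + x).
have u0 : u 0 = f x by rewrite /u scale0r add0r.
have du : is_derive (0 : R) 1 u l.
  apply: is_derive_same_line df => h.
  by rewrite /u addr0 scaler1.
have := is_derive1_comp (x := 0) (f := phi) (g := u) (a := a) (b := l).
rewrite u0 => /(_ dphi du); apply: is_derive_same_line => h.
by rewrite /u /= addr0 scaler1.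
Qed.

Lemma derive_is_derive (V : normedModType R) (f : V -> R) x v :
  derivable f x v -> is_derive x v f ('D_v f x).
Proof. by move=> df; split. Qed.

Lemma is_derive_mul (V : normedModType R) (f g : V -> R) x v df dg :
  is_derive x v f df -> is_derive x v g dg ->
  is_derive x v (fun z => f z * g z) (f x * dg + g x * df).
Proof. by move=> hf hg; exact: (is_deriveM hf hg). Qed.

End directional_derivative.

Section smooth_algebra.
Context {R : realType} {V : normedModType R}.
Implicit Types (f g : V -> R) (P : set (V -> R)).

(** The functions built from those of P by sums and products.  A set P of
    continuous functions whose derivatives lie in the algebra that it generates
    consists of smooth functions: this replaces formulas for higher derivatives. *)
Inductive generated P : (V -> R) -> Prop :=
| generated_base f : P f -> generated P f
| generated_add f g : generated P f -> generated P g -> generated P (fun x => f x + g x)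
| generated_mul f g : generated P f -> generated P g -> generated P (fun x => f x * g x).

Definition derivation_closed P := forall f, P f ->
  continuous f /\ forall w, (forall x, derivable f x w) /\ generated P ('D_w f).

Lemma generated_derivation_closed P : derivation_closed P ->
  derivation_closed (generated P).
Proof.
move=> P_closed f Pf.
suff [cf df] : continuous f /\ forall w, (forall x, derivable f x w) /\ generated P ('D_w f).
  by split => // w; have [df1 df2] := df w; split => //; exact: generated_base.
elim: Pf => {f} [f Pf|f g _ [cf df] _ [cg dg]|f g Pf [cf df] Pg [cg dg]].
- exact: P_closed.
- split => [x|w]; first exact: cvgD (cf x) (cg x).
  have [df1 df2] := df w; have [dg1 dg2] := dg w.
  split => [x|]; first exact: derivableD (df1 x) (dg1 x).
  rewrite (_ : 'D_w _ = fun x => 'D_w f x + 'D_w g x); first exact: generated_add.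
  by apply/funext => x; rewrite -deriveD.
- split => [x|w]; first exact: cvgM (cf x) (cg x).
  have [df1 df2] := df w; have [dg1 dg2] := dg w.
  split => [x|]; first exact: derivableM (df1 x) (dg1 x).
  rewrite (_ : 'D_w _ = fun x => f x * 'D_w g x + g x * 'D_w f x).
    by apply: generated_add; apply: generated_mul.
  by apply/funext => x; rewrite -[RHS](deriveM (df1 x) (dg1 x)).
Qed.

Lemma smooth_generated P f : derivation_closed P -> generated P f -> smooth f.
Proof.
move=> /generated_derivation_closed gP Pf.
have gen s : generated P (iter_derive s f).
  elim: s => [//|w s IHs] /=; have [_ /(_ w)[_]] := gP _ IHs.
  set D := 'D_w _; elim=> [g //|g1 g2 _ + _ +|g1 g2 _ + _ +]; first exact: generated_add.
  exact: generated_mul.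
move=> s; have [cs ds] := gP _ (gen s); split => // w x.
by have [] := ds w.
Qed.

Lemma smooth_continuous f : smooth f -> continuous f.
Proof. by move=> sf; have [] := sf [::]. Qed.

Lemma smooth_derivable f w x : smooth f -> derivable f x w.
Proof. by move=> sf; have [_] := sf [::]; exact. Qed.

Lemma smooth_derive f w : smooth f -> smooth ('D_w f).
Proof.
move=> sf s; have := sf (rcons s w).
by rewrite /iter_derive foldr_rcons (_ : (fun x => _) = 'D_w f).
Qed.

Lemma smooth_derivation_closed P : P `<=` @smooth R V ->
  (forall f w, P f -> P ('D_w f)) -> derivation_closed P.
Proof.
move=> Ps PD f Pf; split=> [|w]; first exact/smooth_continuous/Ps.
split => [x|]; first exact/smooth_derivable/Ps.
by apply: generated_base; exact: PD.
Qed.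

Lemma smooth_cst (c : R) : smooth (fun _ : V => c).
Proof.
apply: (@smooth_generated [set f | exists c, f = fun=> c]); last first.
  by apply: generated_base; exists c.
move=> _ [a ->]; split=> [x|w]; first exact: cvg_cst.
split=> [x|]; first exact: derivable_cst.
by apply: generated_base; exists 0; apply/funext => x; exact: derive_cst.
Qed.

Let smooth_closed : derivation_closed (@smooth R V).
Proof. by apply: smooth_derivation_closed => // f w; exact: smooth_derive. Qed.

Lemma smoothD f g : smooth f -> smooth g -> smooth (fun x => f x + g x).
Proof.
move=> sf sg; apply: (smooth_generated smooth_closed).
by apply: generated_add; apply: generated_base.
Qed.

Lemma smoothM f g : smooth f -> smooth g -> smooth (fun x => f x * g x).
Proof.
move=> sf sg; apply: (smooth_generated smooth_closed).
by apply: generated_mul; apply: generated_base.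
Qed.

End smooth_algebra.

(** * A smooth approximation of the modulus *)

Section regularized_modulus.
Context {R : realType}.
Variable eps : R.
Hypothesis eps_gt0 : 0 < eps.

Definition regularized_norm (s : R) : R := Num.sqrt (s ^+ 2 + eps ^+ 2).

Lemma regularized_norm_sqr s : regularized_norm s ^+ 2 = s ^+ 2 + eps ^+ 2.
Proof. by rewrite sqr_sqrtr// addr_ge0// sqr_ge0. Qed.

Let pos s : 0 < s ^+ 2 + eps ^+ 2.
Proof. by rewrite ltr_wpDl ?sqr_ge0// exprn_gt0. Qed.

Lemma regularized_norm_gt0 s : 0 < regularized_norm s.
Proof. by rewrite sqrtr_gt0. Qed.

Lemma norm_le_regularized s : `|s| <= regularized_norm s.
Proof.
rewrite -sqrtr_sqr; apply: ler_wsqrtr; rewrite lerDl sqr_ge0 //.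
Qed.

Lemma eps_le_regularized s : eps <= regularized_norm s.
Proof.
by rewrite -[leLHS]gtr0_norm// -sqrtr_sqr; apply: ler_wsqrtr; rewrite lerDr sqr_ge0.
Qed.

Lemma regularized_norm0 : regularized_norm 0 = eps.
Proof. by rewrite /regularized_norm expr0n /= add0r sqrtr_sqr gtr0_norm. Qed.

Lemma is_derive_regularized (s : R) :
  is_derive s 1 regularized_norm (s * (regularized_norm s)^-1).
Proof.
have dsq : is_derive s 1 (fun s : R => s ^+ 2 + eps ^+ 2) (2 * s).
  have d1 := is_derive_mul (is_derive_id s (1 : R)) (is_derive_id s (1 : R)).
  have := is_deriveD d1 (is_derive_cst (eps ^+ 2) s 1).
  rewrite addr0 (_ : s * 1 + s * 1 = 2 * s); last by ring.
  by apply: is_derive_same_line => h; rewrite /= expr2.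
have := is_derive_comp1 (phi := @Num.sqrt R) (f := fun s : R => s ^+ 2 + eps ^+ 2)
  (is_derive1_sqrt (pos s)) dsq.
rewrite (_ : _ * _ = s * (regularized_norm s)^-1)//.
by rewrite -/(regularized_norm s); have := regularized_norm_gt0 s => h; field; rewrite gt_eqF.
Qed.

Lemma is_derive_inv_regularized (s : R) :
  is_derive s 1 (fun s => (regularized_norm s)^-1) (- s * (regularized_norm s)^-1 ^+ 3).
Proof.
have h := regularized_norm_gt0 s.
have := is_deriveV _ (is_derive_regularized s) => /(_ (lt0r_neq0 h)).
rewrite (_ : _ *: _ = - s * (regularized_norm s)^-1 ^+ 3)//.
by rewrite /GRing.scale /=; field; rewrite gt_eqF.
Qed.

Section smooth_composition.
Context {V : normedModType R}.
Variable f : V -> R.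
Hypothesis sf : smooth f.
Local Notation r := (fun x => (regularized_norm (f x))^-1).

Lemma is_derive_regularized_comp w x :
  is_derive x w (fun x => regularized_norm (f x)) (f x * r x * 'D_w f x).
Proof.
exact: (is_derive_comp1 (phi := regularized_norm) (f := f)
  (is_derive_regularized (f x)) (derive_is_derive (smooth_derivable sf))).
Qed.

Lemma is_derive_inv_regularized_comp w x :
  is_derive x w r (- f x * r x ^+ 3 * 'D_w f x).
Proof.
exact: (is_derive_comp1 (phi := fun s => (regularized_norm s)^-1) (f := f)
  (is_derive_inv_regularized (f x)) (derive_is_derive (smooth_derivable sf))).
Qed.

Lemma continuous_sqrt_comp : continuous (fun x => regularized_norm (f x)).
Proof.
move=> x; apply: (@continuous_comp _ _ _ f regularized_norm).
  exact: smooth_continuous.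
have [d _] := is_derive_regularized (f x).
exact/differentiable_continuous/derivable1_diffP.
Qed.

Lemma continuous_inv_comp : continuous r.
Proof.
move=> x; apply: cvgV; last exact: continuous_sqrt_comp.
by rewrite gt_eqF// regularized_norm_gt0.
Qed.

(** Smooth functions and r = (f^2 + eps^2)^(-1/2) together are closed under
    derivation, up to sums and products, as D r = - f r^3 D f. *)
Lemma smooth_inv_regularized : smooth r.
Proof.
pose P : set (V -> R) := [set g | smooth g \/ g = r].
have Ps g : smooth g -> generated P g by move=> sg; apply: generated_base; left.
have Pr : generated P r by apply: generated_base; right.
apply: (smooth_generated _ Pr) => g [sg|->].
  split=> [|w]; first exact: smooth_continuous.
  by split=> [x|]; [exact: smooth_derivable|apply: Ps; exact: smooth_derive].
split=> [|w]; first exact: continuous_inv_comp.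
split=> [x|]; first by case: (is_derive_inv_regularized_comp w x).
rewrite (_ : 'D_w _ = fun x => ((-1) * f x) * (r x * (r x * r x)) * 'D_w f x).
  apply: generated_mul; last exact/Ps/smooth_derive.
  apply: generated_mul; first by apply: Ps; apply: smoothM => //; exact: smooth_cst.
  by do !apply: generated_mul.
apply/funext => x; have [_ ->] := is_derive_inv_regularized_comp w x.
by rewrite mulN1r !exprS expr0 mulr1.
Qed.

Lemma smooth_regularized : smooth (fun x => regularized_norm (f x)).
Proof.
rewrite (_ : (fun x => _) = fun x => (f x * f x + eps ^+ 2) * r x).
  apply: smoothM; last exact: smooth_inv_regularized.
  by apply: smoothD; [exact: smoothM|exact: smooth_cst].
apply/funext => x; rewrite -expr2 -regularized_norm_sqr expr2 mulfK//.
by rewrite gt_eqF// regularized_norm_gt0.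
Qed.

End smooth_composition.
End regularized_modulus.

Section slices.
Context {R : realType} {n : nat}.
Implicit Types psi : R * 'rV[R]_n -> R.

Lemma derive_space_slice psi t x w :
  (derivable (fun x => psi (t, x)) x w <-> derivable psi (t, x) (0, w)) /\
  'D_w (fun x => psi (t, x)) x = 'D_(0, w) psi (t, x).
Proof.
apply: derive_same_line => h; congr psi; rewrite [RHS]surjective_pairing /=.
by rewrite scaler0 add0r.
Qed.

Lemma continuous_space_slice psi t : continuous psi -> continuous (fun x => psi (t, x)).
Proof.
move=> cpsi x; apply: (@continuous_comp _ _ _ (fun x => (t, x)) psi); last exact: cpsi.
by apply: (@cvg_pair _ _ _ (nbhs x) (nbhs t) (nbhs x)); [exact: cvg_cst|exact: cvg_id].
Qed.

Lemma continuous_time_slice psi x : continuous psi -> continuous (fun t => psi (t, x)).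
Proof.
move=> cpsi t; apply: (@continuous_comp _ _ _ (fun t => (t, x)) psi); last exact: cpsi.
by apply: (@cvg_pair _ _ _ (nbhs t) (nbhs t) (nbhs x)); [exact: cvg_id|exact: cvg_cst].
Qed.

Lemma smooth_space_slice psi t : smooth psi -> smooth (fun x => psi (t, x)).
Proof.
move=> spsi s.
have E : iter_derive s (fun x => psi (t, x)) =
    fun x => iter_derive [seq (0, w) | w <- s] psi (t, x).
  elim: s => [//|w s IHs] /=; rewrite IHs; apply/funext => x.
  by case: (derive_space_slice (iter_derive [seq (0, w) | w <- s] psi) t x w).
rewrite E; have [cs ds] := spsi [seq (0, w) | w <- s]; split.
  exact: continuous_space_slice.
by move=> w x; apply/(derive_space_slice _ _ _ _).1; exact: ds.
Qed.

Lemma supported_in_space_slice psi B t : supported_in B psi ->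
  supported_in B (fun x => psi (t, x)).
Proof.
by move=> pB x xB; apply: pB; rewrite prod_normE lt_max /= xB orbT.
Qed.

Lemma supported_in_time_slice psi B x : supported_in B psi ->
  supported_in B (fun t => psi (t, x)).
Proof. by move=> pB t tB; apply: pB; rewrite prod_normE lt_max /= tB. Qed.

End slices.
(** * Integrals of derivatives *)

Section fubini_ae.
Context d1 d2 (T1 : measurableType d1) (T2 : measurableType d2) (R : realType).
Variables (m1 : {sigma_finite_measure set T1 -> \bar R}).
Variables (m2 : {sigma_finite_measure set T2 -> \bar R}).
Variable F : T1 * T2 -> R.
Hypothesis IF : integrable_fun (m1 \x m2)%E F.

(** Real-valued integrals send infinite values to 0; for almost every slice this
    does not happen, so the value of the inner integral can be given almost
    everywhere as a real number. *)
Lemma Rfubini_ae1 (c : T1 -> R) : measurable_fun setT c ->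
  {ae m1, forall x, \int[m2]_y F (x, y) = c x} ->
  \int[(m1 \x m2)%E]_z F z = \int[m1]_x c x.
Proof.
move=> mc Fc; congr fine; rewrite -(integral12_prod_meas1 IF).
apply: ae_eq_integral => //; [exact: measurable_fubini_F IF|exact/measurable_EFinP|].
have := ae_integrable1 IF; apply: filterS2 Fc => x <- Fx _.
by rewrite /Rintegral /= /fubini_F fineK//; exact: integrable_fin_num.
Qed.

Lemma Rfubini_ae2 (c : T2 -> R) : measurable_fun setT c ->
  {ae m2, forall y, \int[m1]_x F (x, y) = c y} ->
  \int[(m1 \x m2)%E]_z F z = \int[m2]_y c y.
Proof.
move=> mc Fc; congr fine; rewrite -(integral21_prod_meas1 IF).
apply: ae_eq_integral => //; [exact: measurable_fubini_G IF|exact/measurable_EFinP|].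
have := ae_integrable2 IF; apply: filterS2 Fc => x <- Fx _.
by rewrite /Rintegral /= /fubini_G fineK//; exact: integrable_fin_num.
Qed.

End fubini_ae.

Section vanishing_integrals.
Context {R : realType}.

(** The fundamental theorem of calculus, for a derivative that vanishes on D
    outside [a, b]; D is the line or the half-line below. *)
Lemma Rintegral_derivative (f f' : R -> R) (D : set R) (a b : R) : a < b ->
  (forall t : R, is_derive t 1 f (f' t)) -> continuous f' ->
  `[a, b]%classic `<=` D -> (forall t, D t -> ~ `[a, b]%classic t -> f' t = 0) ->
  \int[lebesgue_measure]_(t in D) f' t = f b - f a.
Proof.
move=> ab df cf' abD f'0.
have cf : continuous f.
  by move=> t; have [d _] := df t; exact/differentiable_continuous/derivable1_diffP.
transitivity (\int[lebesgue_measure]_(t in `[a, b]) f' t).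
  rewrite [LHS]Rintegral_mkcond [RHS]Rintegral_mkcond; congr Rintegral.
  apply/funext => t; rewrite !patchE.
  case: (boolP (t \in `[a, b]%classic)) => tab.
    by rewrite mem_set//; apply: abD; rewrite -inE.
  case: ifPn => // /set_mem tD; apply: f'0 => // tab'.
  by move: tab; rewrite mem_set.
rewrite /Rintegral (continuous_FTC2 ab (F := f)) -?EFinB//.
- exact: continuous_subspaceT.
- split=> [t _||]; first by case: (df t).
    by apply: cvg_at_right_filter; exact: cf.
  by apply: cvg_at_left_filter; exact: cf.
- by move=> t _; rewrite derive1E; case: (df t).
Qed.

Lemma Rintegral_derivative_line (f f' : R -> R) B :
  (forall t : R, is_derive t 1 f (f' t)) -> continuous f' ->
  supported_in B f -> supported_in B f' ->
  \int[lebesgue_measure]_t f' t = 0.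
Proof.
move=> df cf' fB f'B; pose b := `|B| + 1.
have Bb : B < b by rewrite (le_lt_trans (ler_norm B))// ltrDl.
have b0 : 0 < b by rewrite ltr_wpDl.
rewrite (@Rintegral_derivative f f' _ (- b) b)//.
- by rewrite !fB ?subrr// ?normrN gtr0_norm.
- by lra.
- move=> t _ /=; rewrite in_itv/= -ler_norml => /negP; rewrite -ltNge => bt.
  by apply: f'B; exact: lt_trans bt.
Qed.

Lemma Rintegral_derivative_half_line (f f' : R -> R) B :
  (forall t : R, is_derive t 1 f (f' t)) -> continuous f' ->
  supported_in B f -> supported_in B f' ->
  \int[lebesgue_measure]_(t in half_line) f' t = - f 0.
Proof.
move=> df cf' fB f'B; pose b := `|B| + 1.
have Bb : B < b by rewrite (le_lt_trans (ler_norm B))// ltrDl.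
have b0 : 0 < b by rewrite ltr_wpDl.
rewrite (@Rintegral_derivative f f' _ 0 b)//.
- by rewrite (fB b) ?sub0r// gtr0_norm.
- by move=> t /=; rewrite /half_line /= !in_itv/= andbT => /andP[].
- move=> t; rewrite /half_line /= !in_itv/= andbT => t0; rewrite t0 /= => /negP.
  by rewrite -ltNge => bt; apply: f'B; rewrite ger0_norm//; exact: lt_trans bt.
Qed.

(** By induction on the dimension: splitting off the first coordinate, the inner
    integral vanishes either by the one-dimensional case (i = 0, integrating first
    in that coordinate) or by the induction hypothesis (i > 0, integrating first in
    the others). *)
Lemma Rintegral_partial_derivative n (i : 'I_n) (g dg : 'rV[R]_n -> R) B :
  (forall x, is_derive x (delta_mx ord0 i) g (dg x)) -> continuous dg ->
  supported_in B g -> supported_in B dg ->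
  \int[lebesgue_measure_rV n]_x dg x = 0.
Proof.
elim: n i g dg => [[]//|n IHn] i g dg Dg cdg gB dgB.
have cdgc : continuous (dg \o @cons_rV R n).
  by move=> z; apply: continuous_comp; [exact: continuous_cons_rV|exact: cdg].
have dgcB : supported_in B (dg \o @cons_rV R n).
  by move=> z zB; apply: dgB; rewrite norm_cons_rV.
have Idgc : integrable_fun (lebesgue_measure \x lebesgue_measure_rV n)%E (dg \o @cons_rV R n).
  by apply: integrable_continuous_prod; split => //; exists B.
have -> : \int[lebesgue_measure_rV n.+1]_x dg x =
    \int[(lebesgue_measure \x lebesgue_measure_rV n)%E]_z dg (cons_rV z).
  congr fine; rewrite [LHS](integral_pushforward (@measurable_cons_rV R n))//.
  exact: ((measurable_EFinP setT dg).2 (continuous_measurable_rV cdg)).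
case: (unliftP ord0 i) Dg => [j ->|->] Dg.
- rewrite (Rfubini_ae1 Idgc (c := fun=> 0))//; first by rewrite /Rintegral integral0.
  apply/aeW => t; apply: (IHn j (fun x => g (cons_rV (t, x)))).
  + move=> x; apply: is_derive_same_line (Dg (cons_rV (t, x))) => h; congr g.
    by apply/rowP => k; rewrite !mxE; case: unliftP => [l ->|->];
      rewrite ?mxE /= ?(inj_eq lift_inj) // mulr0 add0r.
  + exact: (@continuous_space_slice _ _ (dg \o @cons_rV R n)).
  + by move=> x xB; apply: gB; rewrite norm_cons_rV prod_normE lt_max xB orbT.
  + exact: (supported_in_space_slice t dgcB).
- rewrite (Rfubini_ae2 Idgc (c := fun=> 0))//; first by rewrite /Rintegral integral0.
  apply/aeW => x; apply: (@Rintegral_derivative_line (fun t => g (cons_rV (t, x))) _ B).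
  + move=> t; apply: is_derive_same_line (Dg (cons_rV (t, x))) => h; congr g.
    apply/rowP => k; rewrite !mxE; case: unliftP => [l ->|->];
      by rewrite ?mxE /= ?mulr0 ?add0r ?mulr1 // scaler1.
  + exact: (@continuous_time_slice _ _ (dg \o @cons_rV R n)).
  + by move=> t tB; apply: gB; rewrite norm_cons_rV prod_normE lt_max tB.
  + exact: (supported_in_time_slice x dgcB).
Qed.

End vanishing_integrals.
(** * Integration over the space-time half space *)

Section finite_sums.
Context d (T : measurableType d) (R : realType) (mu : {measure set T -> \bar R}).
Variables (D : set T) (mD : measurable D).

Lemma integrable_funD_in (f g : T -> R) : mu.-integrable D (EFin \o f) ->
  mu.-integrable D (EFin \o g) -> mu.-integrable D (EFin \o (fun x => f x + g x)).
Proof. by move=> If Ig; have := integrableD mD If Ig; exact: eq_integrable. Qed.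

Lemma integrable_funB_in (f g : T -> R) : mu.-integrable D (EFin \o f) ->
  mu.-integrable D (EFin \o g) -> mu.-integrable D (EFin \o (fun x => f x - g x)).
Proof. by move=> If Ig; have := integrableB mD If Ig; exact: eq_integrable. Qed.

Lemma integrable_funZ_in (a : R) (f : T -> R) : mu.-integrable D (EFin \o f) ->
  mu.-integrable D (EFin \o (fun x => a * f x)).
Proof. by move=> If; have := integrableZl mD a If; exact: eq_integrable. Qed.

Lemma Rintegral_sum (I : Type) (s : seq I) (f : I -> T -> R) :
  (forall i, mu.-integrable D (EFin \o f i)) ->
  mu.-integrable D (EFin \o (fun x => \sum_(i <- s) f i x)) /\
  \int[mu]_(x in D) (\sum_(i <- s) f i x) = \sum_(i <- s) \int[mu]_(x in D) f i x.
Proof.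
move=> If; elim: s => [|i s [Is IH]].
  rewrite big_nil (_ : (fun x => _) = fun=> 0); last by apply/funext => x; rewrite big_nil.
  by split; [exact: integrable0|rewrite /Rintegral integral0].
rewrite big_cons (_ : (fun x => _) = fun x => f i x + \sum_(j <- s) f j x); last first.
  by apply/funext => x; rewrite big_cons.
by split; [exact: integrable_funD_in|rewrite RintegralD// IH].
Qed.

End finite_sums.

Section spacetime_integrals.
Context {R : realType} {d : nat}.
Local Notation vol := (lebesgue_measure_rV d).
Local Notation st := (lebesgue_measure \x vol)%E.
Local Notation S := (@spacetime R d : set (measurableTypeR R * 'rV[R]_d)).
Implicit Types F G : R * 'rV[R]_d -> R.

Lemma measurable_spacetime : measurable S.
Proof. by apply: measurableX => //; exact: measurable_itv. Qed.

Lemma Rintegral_spacetime_time F : st.-integrable S (EFin \o F) ->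
  {ae lebesgue_measure, forall t : R, 0 < t -> \int[vol]_x F (t, x) = 0} ->
  \int[st]_(z in S) F z = 0.
Proof.
move=> IF F0; rewrite Rintegral_mkcond.
have IFS : integrable_fun st (F \_ S).
  have /integrable_mkcond := IF; move=> /(_ measurable_spacetime).
  by apply: eq_integrable => // z _; rewrite /= restrict_EFin.
rewrite (Rfubini_ae1 IFS (c := fun=> 0))//; first by rewrite /Rintegral integral0.
have ne0 : {ae (@lebesgue_measure R), forall t : R, t != 0}.
  exists [set 0]; split => //; first exact: lebesgue_measure_set1.
  by move=> t /= /negP; rewrite negbK => /eqP.
move: F0 ne0.
apply: (@filterS2 _ _ (ae_filter_ringOfSetsType (@lebesgue_measure R))) => t Ft t0.
have [tpos|tneg] := ltP 0 t.
  rewrite -[RHS](Ft tpos); apply: eq_Rintegral => x _; rewrite patchE mem_set//.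
  by split => //=; rewrite /half_line /= in_itv/= (ltW tpos).
transitivity (\int[vol]_x (0 : R)); last by rewrite /Rintegral integral0.
apply: eq_Rintegral => x _; rewrite patchE memNset//= => -[].
rewrite /half_line /= in_itv/= andbT => t_ge0 _.
by move: t0; rewrite eq_le tneg t_ge0.
Qed.

Lemma Rintegral_spacetime_space F (c : 'rV[R]_d -> R) : st.-integrable S (EFin \o F) ->
  measurable_fun setT c ->
  (forall x, \int[lebesgue_measure]_(t in half_line) F (t, x) = c x) ->
  \int[st]_(z in S) F z = \int[vol]_x c x.
Proof.
move=> IF mc Fc; rewrite Rintegral_mkcond.
have IFS : integrable_fun st (F \_ S).
  have /integrable_mkcond := IF; move=> /(_ measurable_spacetime).
  by apply: eq_integrable => // z _; rewrite /= restrict_EFin.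
apply: (Rfubini_ae2 IFS mc); apply/aeW => x; rewrite -Fc [RHS]Rintegral_mkcond.
apply: eq_Rintegral => t _; rewrite !patchE.
by congr (if _ then _ else _); apply/idP/idP => [/set_mem[]|/set_mem] *; exact: mem_set.
Qed.

Lemma integrable_spacetime G : continuous_csupp G -> st.-integrable S (EFin \o G).
Proof.
move=> /integrable_continuous_prod; apply: integrableS => //.
exact: measurable_spacetime.
Qed.

(** The integrand lives on a compact subset of the half space, where u is
    integrable and G bounded. *)
Lemma integrable_spacetime_coef (u : R * 'rV[R]_d -> R) G :
  loc_integrable_spacetime u -> continuous_csupp G ->
  st.-integrable S (EFin \o (fun z => u z * G z)).
Proof.
move=> Iu [cG [B GB]]; pose K := S `&` closed_norm_ball B.
have cS : closed (@spacetime R d).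
  rewrite (_ : spacetime = fst @^-1` (@half_line R)); last first.
    by apply/seteqP; split => [z []|z].
  apply: closed_comp => [z _|]; first exact: cvg_fst.
  rewrite (_ : half_line = [set x : R | 0 <= x]); first exact: closed_ge.
  by apply/seteqP; split => x; rewrite /half_line /= in_itv/= andbT.
have cK : compact K.
  apply: (subclosed_compact _ (@compact_ball_prod R d B)); last by move=> z [].
  by apply: closedI => //; exact: closed_closed_norm_ball.
have mK : measurable (K : set (measurableTypeR R * 'rV[R]_d)).
  by apply: measurableI; [exact: measurable_spacetime|
    apply: closed_measurable_prod; exact: closed_closed_norm_ball].
have [M M0 GM] := bounded_continuous_csupp (@compact_ball_prod R d B) cG GB.
have IK : st.-integrable K (EFin \o (fun z => u z * G z)).
  have IuK : st.-integrable K (EFin \o u) by apply: Iu => // z [].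
  apply: (integrableMl mK IuK).
    by apply: measurable_funTS; exact: continuous_measurable_prod.
  by exists M; split; [exact: num_real|move=> r Mr z _; exact: le_trans (GM z) (ltW Mr)].
apply/integrable_mkcond; first exact: measurable_spacetime.
have /integrable_mkcond := IK; move=> /(_ mK); apply: eq_integrable => // z _.
rewrite !patchE; case: (boolP (z \in S)) => zS.
  case: ifPn => // zK; rewrite /= GB ?mulr0// ltNge; apply/negP => zB.
  by move/negP: zK; apply; rewrite inE; split => //; rewrite -inE.
by rewrite memNset// => -[zS' _]; move/negP: zS; apply; rewrite inE.
Qed.

End spacetime_integrals.
(** * The a priori estimate *)

Section energy_estimate.
Context {R : realType} {d : nat}.
Local Notation vol := (lebesgue_measure_rV d).
Local Notation st := (lebesgue_measure \x vol)%E.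
Local Notation S := (@spacetime R d : set (measurableTypeR R * 'rV[R]_d)).
Local Notation E := (R * 'rV[R]_d)%type.
Variables (nu : R) (v : R -> 'rV[R]_d -> 'rV[R]_d).
Hypothesis nu_ge0 : 0 <= nu.
Hypothesis v_loc : forall i, loc_integrable_spacetime (fun z => v z.1 z.2 ord0 i).
Hypothesis v_div : divergence_free v.

(** The operator T of the weak formulation, formally minus the adjoint of
    phi |-> d_t phi - div (phi v) - nu Delta phi. *)
Definition adjoint_transport (psi : E -> R) (z : E) : R :=
  'D_(1, 0) psi z
  - \sum_(i < d) v z.1 z.2 ord0 i * 'D_(space_dir i) psi z
  + nu * \sum_(i < d) 'D_(space_dir i) (fun y => 'D_(space_dir i) psi y) z.

Section test_function.
Variables (psi : E -> R) (B : R).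
Hypotheses (s_psi : smooth psi) (psiB : supported_in B psi).

Let dpsi w : E -> R := 'D_w psi.
Let dxx i : E -> R := 'D_(space_dir i) ('D_(space_dir i) psi).

Let csupp (f : E -> R) : smooth f -> supported_in B f -> continuous_csupp f.
Proof. by move=> sf fB; split; [exact: smooth_continuous|exists B]. Qed.

Let csupp_d w : continuous_csupp (dpsi w).
Proof. by apply: csupp; [exact: smooth_derive|exact: supported_in_derive]. Qed.

Let csupp_dd i : continuous_csupp (dxx i).
Proof. by apply: csupp; [do 2!apply: smooth_derive|do 2!apply: supported_in_derive]. Qed.

Lemma adjoint_transport_integrable :
  st.-integrable S (EFin \o adjoint_transport psi).
Proof.
have mS := @measurable_spacetime R d.
apply: integrable_funD_in => //.
  apply: integrable_funB_in => //; first exact: integrable_spacetime (csupp_d _).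
  apply: (Rintegral_sum mS _ _).1 => i.
  exact: integrable_spacetime_coef (v_loc i) (csupp_d _).
apply: integrable_funZ_in => //.
by apply: (Rintegral_sum mS _ _).1 => i; exact: integrable_spacetime (csupp_dd i).
Qed.

Variable eps : R.
Hypothesis eps_gt0 : 0 < eps.

Let r (z : E) : R := (regularized_norm eps (psi z))^-1.
(* The regularized sign b'(psi). *)
Let sg z : R := psi z * r z.
Let b z : R := regularized_norm eps (psi z) - eps.

Let r_gt0 z : 0 < r z.
Proof. by rewrite invr_gt0 regularized_norm_gt0. Qed.

Let s_r : smooth r. Proof. exact: smooth_inv_regularized. Qed.
Let s_sg : smooth sg. Proof. exact: smoothM. Qed.
Let s_b : smooth b.
Proof. by apply: smoothD; [exact: smooth_regularized|exact: smooth_cst]. Qed.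

Let bB : supported_in B b.
Proof. by move=> z zB; rewrite /b psiB// regularized_norm0// subrr. Qed.

Let sg_le1 z : `|sg z| <= 1.
Proof.
rewrite normrM (gtr0_norm (r_gt0 z)) ler_pdivrMr ?regularized_norm_gt0//.
by rewrite mul1r norm_le_regularized.
Qed.

Let is_derive_b w z : is_derive z w b (sg z * dpsi w z).
Proof.
have := is_deriveD (is_derive_regularized_comp eps_gt0 s_psi w z)
  (is_derive_cst (- eps) z w).
by rewrite addr0.
Qed.

(* b''(s) = eps^2 / (s^2 + eps^2)^(3/2). *)
Let is_derive_sg w z :
  is_derive z w sg (eps ^+ 2 * r z ^+ 3 * dpsi w z).
Proof.
have := is_derive_mul (derive_is_derive (smooth_derivable s_psi))
  (is_derive_inv_regularized_comp eps_gt0 s_psi w z).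
rewrite (_ : _ + _ = eps ^+ 2 * r z ^+ 3 * dpsi w z)//.
rewrite -/(dpsi w z) -/(r z).
have -> : eps ^+ 2 = (r z)^-1 ^+ 2 - psi z ^+ 2.
  by rewrite /r invrK regularized_norm_sqr addrAC subrr add0r.
by field; rewrite gt_eqF.
Qed.

Let flux i z : R := sg z * dpsi (space_dir i) z.
Let dflux i z : R := eps ^+ 2 * r z ^+ 3 * dpsi (space_dir i) z ^+ 2 + sg z * dxx i z.

Let is_derive_flux i z : is_derive z (space_dir i) (flux i) (dflux i z).
Proof.
have := is_derive_mul (is_derive_sg (space_dir i) z)
  (derive_is_derive (smooth_derivable (smooth_derive (space_dir i) s_psi))).
rewrite (_ : _ + _ = dflux i z)//.
rewrite /dflux -/(dpsi (space_dir i) z) -/(dxx i z); ring.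
Qed.

Let csupp_flux w : continuous_csupp (fun z => sg z * dpsi w z).
Proof.
apply: csupp; first by apply: smoothM => //; exact: smooth_derive.
by move=> z zB; rewrite /dpsi (supported_in_derive w psiB)// mulr0.
Qed.

Let csupp_dflux i : continuous_csupp (dflux i).
Proof.
rewrite (_ : dflux i = 'D_(space_dir i) (flux i)).
  apply: csupp.
    by apply: smooth_derive; apply: smoothM => //; exact: smooth_derive.
  apply: supported_in_derive => z zB.
  by rewrite /flux /dpsi (supported_in_derive _ psiB)// mulr0.
by apply/funext => z; case: (is_derive_flux i z).
Qed.

Let mS := @measurable_spacetime R d.

Let time_part : \int[st]_(z in S) (sg z * dpsi (1, 0) z) = - \int[vol]_x b (0, x).
Proof.
have cb : continuous_csupp (fun x => b (0, x)).
  split; first exact/continuous_space_slice/smooth_continuous.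
  by exists B; exact: supported_in_space_slice.
rewrite (Rintegral_spacetime_space (integrable_spacetime (csupp_flux (1, 0)))
  (c := fun x => - b (0, x))).
- under eq_Rintegral do rewrite -mulN1r.
  by rewrite RintegralZl ?mulN1r//; exact: integrable_continuous_rV.
- by case: cb => cb _; apply: continuous_measurable_rV => x; exact: (cvgN (cb x)).
- move=> x; apply: (@Rintegral_derivative_half_line _ (fun t => b (t, x)) _ B).
  + move=> t; apply: is_derive_same_line (is_derive_b (1, 0) (t, x)) => h.
    by congr b; rewrite [LHS]surjective_pairing /= scaler0 add0r.
  + apply: (@continuous_time_slice _ _ (fun z => sg z * dpsi (1, 0) z)).
    by case: (csupp_flux (1, 0)).
  + exact: (supported_in_time_slice x bB).
  + move=> t tB; rewrite /dpsi (supported_in_derive _ psiB) ?mulr0//.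
    by rewrite prod_normE lt_max tB.
Qed.

Let drift z := \sum_(i < d) v z.1 z.2 ord0 i * flux i z.

Let integrable_drift : st.-integrable S (EFin \o drift).
Proof.
apply: (Rintegral_sum mS _ _).1 => i.
exact: integrable_spacetime_coef (v_loc i) (csupp_flux _).
Qed.

(* Here b (t, .) is the test function in the definition of the divergence. *)
Let drift_part : \int[st]_(z in S) drift z = 0.
Proof.
apply: Rintegral_spacetime_time => //.
move: v_div.
apply: (@filterS _ _ (ae_filter_ringOfSetsType (@lebesgue_measure R))) => t vt t0.
rewrite -(vt t0 (fun x => b (t, x))); last first.
  split; first exact: smooth_space_slice.
  apply: (support_supported_in (@compact_ball_rV R d B)).
  exact: supported_in_space_slice.
apply: eq_Rintegral => x _; apply: eq_bigr => i _; congr (_ * _) => /=.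
have [_ ->] := derive_space_slice b t x (delta_mx ord0 i).
by case: (is_derive_b (space_dir i) (t, x)) => _ ->.
Qed.

Let diffusion_part i : \int[st]_(z in S) dflux i z = 0.
Proof.
apply: Rintegral_spacetime_time; first exact: integrable_spacetime (csupp_dflux i).
apply/aeW => t _.
have fluxB : supported_in B (flux i).
  by move=> z zB; rewrite /flux /dpsi (supported_in_derive _ psiB)// mulr0.
have dfluxB : supported_in B (dflux i).
  rewrite (_ : dflux i = 'D_(space_dir i) (flux i)); first exact: supported_in_derive.
  by apply/funext => z; case: (is_derive_flux i z).
apply: (@Rintegral_partial_derivative _ _ i (fun x => flux i (t, x)) _ B).
- move=> x; apply: is_derive_same_line (is_derive_flux i (t, x)) => h.
  by congr flux; rewrite [LHS]surjective_pairing /= scaler0 add0r.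
- by apply: (@continuous_space_slice _ _ (dflux i)); case: (csupp_dflux i).
- exact: (supported_in_space_slice t fluxB).
- exact: (supported_in_space_slice t dfluxB).
Qed.

(** With sg = b'(psi), the function P in the proof is the divergence-form upper
    bound of sg (T psi); its integral is - int b(psi(0, x)) dx, while
    sg (T psi) >= - |T psi|. *)
Lemma regularized_energy_estimate :
  \int[vol]_x (regularized_norm eps (psi (0, x)) - eps) <=
  \int[st]_(z in S) `|adjoint_transport psi z|.
Proof.
pose P z := sg z * dpsi (1, 0) z - drift z + nu * \sum_(i < d) dflux i z.
have I1 := integrable_spacetime (csupp_flux (1, 0)).
have [I3 int3] := Rintegral_sum mS (index_enum 'I_d)
  (fun i => integrable_spacetime (csupp_dflux i)).
have IP : st.-integrable S (EFin \o P).
  apply: integrable_funD_in => //; last exact: integrable_funZ_in.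
  exact: integrable_funB_in.
have intP : \int[st]_(z in S) P z = - \int[vol]_x b (0, x).
  rewrite RintegralD//; [|exact: integrable_funB_in|exact: integrable_funZ_in].
  rewrite RintegralB// RintegralZl// int3 time_part drift_part.
  by rewrite big1 ?mulr0 ?addr0 ?subr0// => i _; exact: diffusion_part.
have IT := adjoint_transport_integrable.
have INT : st.-integrable S (EFin \o (fun z => - `|adjoint_transport psi z|)).
  have := integrable_funZ_in mS (-1) (integrable_norm IT).
  by apply: eq_integrable => // z _ /=; rewrite mulN1r.
rewrite -lerN2 -intP (_ : - _ = \int[st]_(z in S) (- `|adjoint_transport psi z|)); last first.
  under [RHS]eq_Rintegral do rewrite -mulN1r.
  by rewrite RintegralZl ?mulN1r//; exact: integrable_norm.
apply: le_Rintegral => // z _.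
apply: (@le_trans _ _ (sg z * adjoint_transport psi z)).
  rewrite lerNl (le_trans (ler_norm _))// normrN normrM ler_piMl//.
rewrite /adjoint_transport /P mulrDr mulrBr lerD//.
  rewrite lerD2l lerN2 /drift mulr_sumr; apply: ler_sum => i _.
  by rewrite /flux mulrCA.
rewrite mulrCA ler_wpM2l// mulr_sumr; apply: ler_sum => i _.
rewrite /dflux lerDr mulr_ge0 ?sqr_ge0// mulr_ge0 ?sqr_ge0// exprn_ge0//.
exact: ltW.
Qed.

End test_function.

(** From b(s) >= |s| - eps, the loss in passing from b(psi(0, .)) to |psi(0, .)| is
    at most eps times the volume of a ball containing the support of psi(0, .). *)
Lemma L1_estimate (psi : E -> R) : smooth_compact psi ->
  \int[vol]_x `|psi (0, x)| <= \int[st]_(z in S) `|adjoint_transport psi z|.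
Proof.
move=> [s_psi /supported_in_support[B psiB]].
pose A : set 'rV[R]_d := closed_norm_ball B.
have mA : measurable A by apply: closed_measurable_rV; exact: closed_closed_norm_ball.
have IA : integrable_fun vol (\1_A : 'rV[R]_d -> R).
  apply: (@integrable_supported _ _ _ vol _ A 1) => //; first exact: measure_ball_rV.
    by move=> x; rewrite indicE; case: (_ \in _); rewrite ?normr1 ?normr0.
  by move=> x Ax; rewrite indicE memNset.
pose c := \int[vol]_x (\1_A x : R).
have c0 : 0 <= c by apply: Rintegral_ge0.
apply/ler_addgt0Pr => e e0; pose eps := e / (c + 1).
have c1 : 0 < c + 1 by rewrite ltr_wpDl.
have eps0 : 0 < eps by rewrite divr_gt0.
have csupp (f : E -> R) : smooth f -> supported_in B f ->
    integrable_fun vol (fun x => f (0, x)).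
  move=> sf fB; apply: integrable_continuous_rV; split.
    exact/continuous_space_slice/smooth_continuous.
  by exists B; exact: supported_in_space_slice.
have Ib : integrable_fun vol (fun x => regularized_norm eps (psi (0, x)) - eps).
  apply: (csupp (fun z => regularized_norm eps (psi z) - eps)).
    by apply: smoothD; [exact: smooth_regularized|exact: smooth_cst].
  by move=> z zB; rewrite psiB// regularized_norm0// subrr.
have Ipsi := integrable_fun_norm (csupp _ s_psi psiB).
apply: (@le_trans _ _ (\int[vol]_x (regularized_norm eps (psi (0, x)) - eps) + eps * c)).
  rewrite -RintegralZl// -RintegralD//; last exact: integrable_funZ.
  apply: le_Rintegral => //.
    by apply: integrable_funD_in => //; exact: integrable_funZ.
  move=> x _; rewrite indicE.
  have := norm_le_regularized eps (psi (0, x)).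
  have := eps_le_regularized eps0 (psi (0, x)).
  case: (boolP (x \in A)) => xA /=; first by rewrite mulr1; lra.
  rewrite mulr0 addr0 (supported_in_space_slice 0 psiB) ?normr0 ?regularized_norm0 ?subrr//.
  by rewrite ltNge; apply/negP => xB; move/negP: xA; apply; exact: mem_set.
apply: lerD; first exact: (regularized_energy_estimate s_psi psiB eps0).
by rewrite /eps mulrAC ler_pdivrMr// ler_wpM2l ?lerDl// ltW.
Qed.

End energy_estimate.
(** * Existence of a bounded solution *)

Section essential_bound.
Context d (T : measurableType d) (R : realType) (mu : {measure set T -> \bar R}).

Lemma Lnorm_oo_le (f : T -> \bar R) (M : R) : 0 <= M ->
  (forall x, `|f x| <= M%:E)%E -> ('N[mu]_+oo[f] <= M%:E)%E.
Proof.
move=> M0 fM; rewrite Lnorm.unlock; case: ifP => _; last by rewrite lee_fin.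
by apply/ess_supP/aeW => x; exact: fM.
Qed.

Lemma ae_le_Lnorm_oo (f : T -> \bar R) : {ae mu, forall x, (`|f x| <= 'N[mu]_+oo[f])%E}.
Proof.
rewrite Lnorm.unlock; case: ifPn => [_|].
  exact: (ess_sup_ge mu (abse \o f)).
rewrite -leNgt => muT; exists setT; split => //.
by apply/eqP; rewrite eq_le muT measure_ge0.
Qed.

Lemma ae_le_Rintegral (f g : T -> R) : integrable_fun mu f -> integrable_fun mu g ->
  (forall x, 0 <= f x) -> (forall x, 0 <= g x) -> {ae mu, forall x, f x <= g x} ->
  \int[mu]_x f x <= \int[mu]_x g x.
Proof.
move=> If Ig f0 g0 fg; apply: fine_le; try exact: integrable_fin_num.
apply: ae_ge0_le_integral => //.
- by move=> x _; rewrite lee_fin.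
- exact: measurable_int If.
- by move=> x _; rewrite lee_fin.
- exact: measurable_int Ig.
- by apply: filterS fg => x fgx _; rewrite lee_fin.
Qed.

End essential_bound.

Lemma patch_lin (T : Type) (R : realType) (D : set T) (a : R) (F G H : T -> R) :
  (forall z, H z = a * F z + G z) ->
  (fun z => a * (F \_ D) z + (G \_ D) z) = H \_ D.
Proof.
move=> FGH; apply/funext => z; rewrite !patchE.
by case: ifP => _; rewrite ?FGH// mulr0 addr0.
Qed.

Section adjoint_linear.
Context {R : realType} {d : nat}.
Local Notation E := (R * 'rV[R]_d)%type.
Variables (nu : R) (v : R -> 'rV[R]_d -> 'rV[R]_d).

Lemma derive_lin (V : normedModType R) (a : R) (f g : V -> R) w x : smooth f -> smooth g ->
  'D_w (fun x => a * f x + g x) x = a * 'D_w f x + 'D_w g x.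
Proof.
move=> sf sg; have df := derive_is_derive (smooth_derivable (w := w) (x := x) sf).
have dg := derive_is_derive (smooth_derivable (w := w) (x := x) sg).
by case: (is_deriveD (is_deriveZ a df) dg).
Qed.

Lemma smooth_lin (V : normedModType R) (a : R) (f g : V -> R) : smooth f -> smooth g ->
  smooth (fun x => a * f x + g x).
Proof. by move=> sf sg; exact: (smoothD (smoothM (smooth_cst a) sf) sg). Qed.

Let transport_lin (a X S L x s l y s' l' : R) :
  X = a * x + y -> S = a * s + s' -> L = a * l + l' ->
  X - S + nu * L = a * (x - s + nu * l) + (y - s' + nu * l').
Proof. by move=> -> -> ->; ring. Qed.

Lemma adjoint_transport_lin (a : R) (f g : E -> R) z : smooth f -> smooth g ->
  adjoint_transport nu v (fun z => a * f z + g z) z =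
  a * adjoint_transport nu v f z + adjoint_transport nu v g z.
Proof.
move=> sf sg; have D1 w y := @derive_lin _ a f g w y sf sg.
apply: transport_lin; first exact: D1.
  rewrite mulr_sumr -big_split; apply: eq_bigr => i _ /=.
  by rewrite D1 mulrDr mulrCA.
rewrite mulr_sumr -big_split; apply: eq_bigr => i _.
have D2 := @derive_lin _ a _ _ (space_dir i) z
  (smooth_derive (space_dir i) sf) (smooth_derive (space_dir i) sg).
have D1i : 'D_(space_dir i) (fun z => a * f z + g z) =
    fun y => a * 'D_(space_dir i) f y + 'D_(space_dir i) g y.
  by apply/funext => y; exact: D1.
exact: etrans (congr1 (fun h : E -> R => 'D_(space_dir i) h z) D1i) D2.
Qed.

Lemma smooth_compact_lin (a : R) (f g : E -> R) : smooth_compact f -> smooth_compact g ->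
  smooth_compact (fun z => a * f z + g z).
Proof.
move=> [sf /supported_in_support[B fB]] [sg /supported_in_support[B' gB]].
split; first exact: (smooth_lin a sf sg).
apply: (support_supported_in (@compact_ball_prod R d (Num.max B B'))) => z.
by rewrite gt_max => /andP[zB zB']; rewrite fB// gB// mulr0 addr0.
Qed.

End adjoint_linear.

Section sigma_finite_spacetime.
Context {R : realType} {d : nat}.

(** The measure of [spacetime_measure] as a constant of its own, so that it can carry
    a sigma-finite structure. *)
Definition spacetime_volume : set (measurableTypeR R * 'rV[R]_d) -> \bar R :=
  (lebesgue_measure \x lebesgue_measure_rV d)%E.

HB.instance Definition _ := Measure.copy spacetime_volume
  (lebesgue_measure \x lebesgue_measure_rV d)%E.

Lemma spacetime_volume_sigma_finite : sigma_finite setT spacetime_volume.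
Proof.
exists (fun k => closed_norm_ball k%:R).
  apply/esym/seteqP; split => // z _; exists (Num.truncn `|z|).+1 => //.
  by rewrite /closed_norm_ball /= ltW// truncnS_gt.
move=> k; split; last exact: measure_ball_prod.
by apply: closed_measurable_prod; exact: closed_closed_norm_ball.
Qed.

HB.instance Definition _ := @Measure_isSigmaFinite.Build _ _ _ spacetime_volume
  spacetime_volume_sigma_finite.

End sigma_finite_spacetime.
Theorem theorem3 (R : realType) (d : nat) (hd : (1 <= d)%N)
    (p q : \bar R) (hp : (1 <= p)%E) (hq : (1 <= q)%E)
    (nu : R) (hnu : 0 <= nu)
    (v : R -> 'rV[R]_d -> 'rV[R]_d)
    (hv : Lp_homogeneous_sobolev (hoelder_conjugate p) (hoelder_conjugate q) v)
    (hdiv : divergence_free v)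
    (phi0 : 'rV[R]_d -> R) (hphi0 : smooth_compact phi0) :
  exists phi : R -> 'rV[R]_d -> R,
    [/\ Linfty_spacetime phi,
        transport_diffusion_solution nu v phi0 phi &
        {ae lebesgue_measure, forall t : R, 0 < t ->
          ('N[lebesgue_measure_rV d]_+oo[EFin \o phi t]
           <= 'N[lebesgue_measure_rV d]_+oo[EFin \o phi0])%E}].
Proof.
have [v_loc _] := hv; have [s0 /supported_in_support[B0 phi0B]] := hphi0.
have c0 := smooth_continuous s0.
pose vol := lebesgue_measure_rV d : {sigma_finite_measure set 'rV[R]_d -> \bar R}.
pose st := (lebesgue_measure \x vol)%E.
pose S := @spacetime R d : set (measurableTypeR R * 'rV[R]_d).
have mS : measurable S by exact: measurable_spacetime.
have [M' M'0 phi0_le] := bounded_continuous_csupp (@compact_ball_rV R d B0) c0 phi0B.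
pose M := fine ('N[vol]_+oo[EFin \o phi0])%E.
have NM : ('N[vol]_+oo[EFin \o phi0] = M%:E)%E.
  rewrite fineK// ge0_fin_numE ?Lnorm_ge0//.
  apply: le_lt_trans (ltry M'); exact: Lnorm_oo_le.
have M0 : 0 <= M by rewrite fine_ge0// Lnorm_ge0.
have phi0M : {ae vol, forall x, `|phi0 x| <= M}.
  by have := ae_le_Lnorm_oo vol (EFin \o phi0); rewrite NM; apply: filterS => x.
(* From here on, T is known through its linearity, its integrability and the a
   priori estimate. *)
have [T TE] : exists T, T = adjoint_transport nu v by exists (adjoint_transport nu v).
have T_lin a f g z : smooth f -> smooth g ->
    T (fun z => a * f z + g z) z = a * T f z + T g z.
  by rewrite TE; exact: adjoint_transport_lin.
pose l (psi : R * 'rV[R]_d -> R) := - \int[vol]_x (phi0 x * psi (0, x)).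
(* The graph of T psi |-> l psi; extended by 0 for negative times, its functions
   are defined on the whole space-time. *)
pose C : set ((measurableTypeR R * 'rV[R]_d -> R) * R) :=
  [set c | exists2 psi, smooth_compact psi & c = (T psi \_ S, l psi)].
have cs_slice (psi : R * 'rV[R]_d -> R) : smooth_compact psi ->
    continuous_csupp (fun x => psi (0, x)).
  move=> [s /supported_in_support[B psiB]]; split.
    exact/continuous_space_slice/smooth_continuous.
  by exists B; exact: supported_in_space_slice.
have I_phi0 (psi : R * 'rV[R]_d -> R) : smooth_compact psi ->
    integrable_fun vol (fun x => phi0 x * psi (0, x)).
  move=> /cs_slice[c [B psiB]]; apply: integrable_continuous_rV; split.
    by move=> x; exact: cvgM (c0 x) (c x).
  by exists B => x xB; rewrite (psiB x xB) mulr0.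
have I_T psi : smooth_compact psi -> integrable_fun st (T psi \_ S).
  move=> [s /supported_in_support[B psiB]].
  have /integrable_mkcond := adjoint_transport_integrable nu v_loc s psiB.
  by rewrite -TE => /(_ mS); apply: eq_integrable => // z _; rewrite /= restrict_EFin.
have l_le psi : smooth_compact psi -> l psi <= M * \int[st]_z `|(T psi \_ S) z|.
  move=> cpsi; have Ipsi := integrable_continuous_rV (cs_slice _ cpsi).
  have -> : \int[st]_z `|(T psi \_ S) z| = \int[st]_(z in S) `|T psi z|.
    rewrite [RHS]Rintegral_mkcond; apply: eq_Rintegral => z _.
    by rewrite !patchE; case: ifP; rewrite ?normr0.
  have := L1_estimate hnu v_loc hdiv cpsi; rewrite -TE => /(ler_wpM2l M0).
  apply: le_trans.
  apply: le_trans (ler_norm _) _; rewrite normrN.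
  apply: le_trans (le_normr_Rintegral _ (I_phi0 _ cpsi)) _ => //.
  rewrite -RintegralZl//; last exact: integrable_fun_norm.
  apply: ae_le_Rintegral.
  - by apply: integrable_fun_norm; exact: I_phi0.
  - by apply: integrable_funZ; exact: integrable_fun_norm.
  - by move=> x.
  - by move=> x; exact: mulr_ge0.
  - by apply: filterS phi0M => x phi0x; rewrite normrM ler_wpM2r.
have C_lin a c c' : C c -> C c' -> C (fun x => a * c.1 x + c'.1 x, a * c.2 + c'.2).
  move=> [f cf ->] [g cg ->]; exists (fun z => a * f z + g z).
    exact: smooth_compact_lin.
  congr pair.
    by apply: patch_lin => z; exact: (T_lin _ _ _ _ cf.1 cg.1).
  rewrite /l /=; have If := I_phi0 _ cf; have Ig := I_phi0 _ cg.
  rewrite mulrN -opprD -RintegralZl// -RintegralD//; last exact: integrable_funZ.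
  by congr (- _); apply: eq_Rintegral => x _; rewrite mulrDr mulrCA.
(* T 0 = 0 is read off from linearity: T 0 is the combination - T 0 + T 0. *)
have C0 : C (fun=> 0, 0).
  have cs0 : smooth_compact (fun _ : R * 'rV[R]_d => 0 : R).
    split; first exact: smooth_cst.
    exact: (support_supported_in (@compact_ball_prod R d 0)).
  have Cz : C (T (fun=> 0) \_ S, l (fun=> 0)) by exists (fun=> 0).
  have := C_lin (-1) _ _ Cz Cz; rewrite /= mulN1r addNr.
  by rewrite (_ : (fun x => _) = fun=> 0)//; apply/funext => x; rewrite mulN1r addNr.
have C_L1 c : C c -> integrable_fun st c.1 by move=> [psi cpsi ->]; exact: I_T.
have C_le c : C c -> c.2 <= M * \int[st]_x `|c.1 x|.
  by move=> [psi cpsi ->]; exact: l_le.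
have [L [L_lin L_le L_C]] := L1_extension M0 C_L1 C0 C_lin C_le.
have [phi [mphi phiM phiE]] :=
  @L1_dual _ _ _ (@spacetime_volume R d) M L M0 (conj L_lin L_le).
exists (fun t x => phi (t, x)).
have phi_eta : (fun z => phi (z.1, z.2)) = phi by apply/funext => -[].
split.
- split; first by rewrite phi_eta; exact: measurable_funTS.
  apply: le_lt_trans (ltry M); apply: Lnorm_oo_le => // z.
  by rewrite patchE; case: ifP => _; rewrite lee_fin ?normr0.
- move=> psi cpsi; rewrite -/(l psi).
  have <- : L (T psi \_ S) = l psi by apply: (L_C (_, _)); exists psi.
  rewrite phiE; last exact: I_T.
  rewrite [LHS]Rintegral_mkcond; apply: eq_Rintegral => z _.
  rewrite !patchE; case: ifP => _; last by rewrite mulr0.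
  by rewrite TE -surjective_pairing.
- apply/aeW => t _; rewrite NM; apply: Lnorm_oo_le => // x.
  by rewrite /= lee_fin.
Qed.
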